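(* Let $n\ge2$. (a) Fix $1\le\ell<n$ and consider the linear map $\iota'_\ell\colon S^{(n)}\to S^{(n)}$ given by $$\iota'_\ell(F)(\{x_{i,r}\}_{i\in I}^{1\le r\le k_i}):=\prod_{r=1}^{k_\ell}(1-x_{\ell,r}^{-1})\cdot F(\{x_{i,r}\}_{i\in I}^{1\le r\le k_i})\quad\text{for } F\in S^{(n)}_{\underline{k}},\ \underline{k}\in\mathbb{N}^I.$$ Then for $F\in S^{(n)}$: $F\in\mathfrak{S}^{(n)}\Longleftrightarrow\iota'_\ell(F)\in\mathfrak{S}^{(n)}$. (b) For any $\underline{k}\in\mathbb{N}^I$ and any collection $g_i(\{x_{i,r}\}_{r=1}^{k_i})\in\mathbb{C}[v,v^{-1}][\{x_{i,r}^{\pm1}\}_{r=1}^{k_i}]^{\Sigma_{k_i}}$ ($i\in I$), consider $$F=(v-v^{-1})^{|\underline{k}|}\cdot\frac{\prod_{i=1}^{n-1}\prod_{1\le r\ne r'\le k_i}(x_{i,r}-v^{-2}x_{i,r'})\cdot\prod_{i=1}^{n-1}g_i(\{x_{i,r}\}_{r=1}^{k_i})}{\prod_{i=1}^{n-2}\prod_{1\le r\le k_i}^{1\le r'\le k_{i+1}}(x_{i,r}-x_{i+1,r'})}.$$ Then $F$ is integral, i.e. $F\in\mathfrak{S}^{(n)}_{\underline{k}}$.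
   Context: $\mathbb{N}=\{0,1,2,\ldots\}$, $I=\{1,\ldots,n-1\}$, $v$ is a formal variable, $[k]_v=\frac{v^k-v^{-k}}{v-v^{-1}}$, $[k]_v!=[1]_v\cdots[k]_v$. For $\underline{k}=(k_1,\ldots,k_{n-1})\in\mathbb{N}^I$ put $\Sigma_{\underline{k}}=\prod_i\Sigma_{k_i}$ (product of symmetric groups) and $|\underline{k}|=\sum_ik_i$. $S^{(n)}=\bigoplus_{\underline{k}\in\mathbb{N}^I}S^{(n)}_{\underline{k}}$, where $S^{(n)}_{\underline{k}}$ is the $\mathbb{C}(v)$-space of $\Sigma_{\underline{k}}$-symmetric rational functions $F$ over $\mathbb{C}(v)$ in $\{x_{i,r}\}_{i\in I}^{1\le r\le k_i}$ satisfying the pole conditions $$F=\frac{f}{\prod_{i=1}^{n-2}\prod_{r\le k_i}^{r'\le k_{i+1}}(x_{i,r}-x_{i+1,r'})},\qquad f\in\mathbb{C}(v)[\{x_{i,r}^{\pm1}\}]^{\Sigma_{\underline{k}}},\qquad(\ast)$$ and the wheel conditions: $F=0$ whenever $x_{i,r_1}=vx_{i+\epsilon,s}=v^2x_{i,r_2}$ for some $\epsilon=\pm1$, $i,i+\epsilon\in I$, $1\le r_1\ne r_2\le k_i$, $1\le s\le k_{i+\epsilon}$. Let $\alpha_1,\ldots,\alpha_{n-1}$ be the simple roots of $\mathfrak{sl}_n$ and $\Delta^+=\{\alpha_j+\cdots+\alpha_i\}_{1\le j\le i<n}$. For $\beta=\alpha_j+\cdots+\alpha_i$ put $j(\beta)=j$,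 $i(\beta)=i$, $[\beta]=\{j,\ldots,i\}$. Order $\Delta^+$ by $\beta\le\beta'$ iff $j(\beta)<j(\beta')$, or $j(\beta)=j(\beta')$ and $i(\beta)\le i(\beta')$. Let $\underline{d}=\{d_\beta\}_{\beta\in\Delta^+}$, $d_\beta\in\mathbb{N}$, with $\sum_\beta d_\beta\beta=\sum_ik_i\alpha_i$. For $F\in S^{(n)}_{\underline{k}}$ with numerator $f$ as in $(\ast)$, split the variables $\{x_{i,r}\}$ into groups, one for each pair $(\beta,s)$, $\beta\in\Delta^+$, $1\le s\le d_\beta$, the group of $(\beta,s)$ containing exactly one variable $x_{i,\cdot}$ for each $i\in[\beta]$; $\phi_{\underline{d}}(F)$ is the result of substituting into $f$ the value $v^{-i}y_{\beta,s}$ for the variable $x_{i,\cdot}$ in group $(\beta,s)$ (independent of the splitting). Let $\widetilde{\mathfrak{S}}^{(n)}_{\underline{k}}\subset S^{(n)}_{\underline{k}}$ consist of $F$ whose numerator satisfies $f\in(v-v^{-1})^{|\underline{k}|}\mathbb{C}[v,v^{-1}][\{x_{i,r}^{\pm1}\}]^{\Sigma_{\underline{k}}}$. Order the pairs by $(\beta,s)\le(\beta',s')$ iff $\beta<\beta'$, or $\beta=\beta'$ and $s\le s'$. Put $A_{\underline{d}}=(v-v^{-1})^{|\underline{k}|}$ and $$B_{\underline{d}}=\prod_{(\beta,s)<(\beta',s')}(y_{\beta,s}-v^{-2}y_{\beta',s'})^{\#\{(j,j')\in[\beta]\times[\beta']:\,j=j'\}-\delta_{\beta,\beta'}}\,(y_{\beta,s}-v^{2}y_{\beta',s'})^{\#\{(j,j')\in[\beta]\times[\beta']:\,j=j'+1\}}.$$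 For $F\in\widetilde{\mathfrak{S}}^{(n)}_{\underline{k}}$, $\phi_{\underline{d}}(F)$ is divisible by $A_{\underline{d}}B_{\underline{d}}$ (a consequence of the wheel conditions) and one sets $\varphi_{\underline{d}}(F)=\phi_{\underline{d}}(F)/(A_{\underline{d}}B_{\underline{d}})\in\mathbb{C}[v,v^{-1}][\{y_{\beta,s}^{\pm1}\}]$. Given positive integers $\underline{t}=\{t_{\beta,r}\}_{\beta\in\Delta^+}^{1\le r\le\ell_\beta}$ ($\ell_\beta\in\mathbb{N}$) with $\sum_{r=1}^{\ell_\beta}t_{\beta,r}=d_\beta$ for all $\beta$, split for each $\beta$ the variables $\{y_{\beta,s}\}_{s=1}^{d_\beta}$ into $\ell_\beta$ groups of sizes $t_{\beta,1},\ldots,t_{\beta,\ell_\beta}$ and specialize the variables in the $r$-th group to $v^{-2}z_{\beta,r},v^{-4}z_{\beta,r},\ldots,v^{-2t_{\beta,r}}z_{\beta,r}$; denote by $\Upsilon_{\underline{d},\underline{t}}(F)\in\mathbb{C}[v,v^{-1}][\{z_{\beta,r}^{\pm1}\}]$ the resulting specialization of $\varphi_{\underline{d}}(F)$. $F\in S^{(n)}_{\underline{k}}$ is *integral* if $F\in\widetilde{\mathfrak{S}}^{(n)}_{\underline{k}}$ and $\Upsilon_{\underline{d},\underline{t}}(F)$ is divisible by $\prod_{\beta\in\Delta^+}\prod_{1\le r\le\ell_\beta}[t_{\beta,r}]_v!$ (in the Laurent polynomial ring over $\mathbb{C}[v,v^{-1}]$) for all such $\underline{d},\underline{t}$. $\mathfrak{S}^{(n)}_{\underline{k}}$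 is the $\mathbb{C}[v,v^{-1}]$-module of integral elements and $\mathfrak{S}^{(n)}=\bigoplus_{\underline{k}\in\mathbb{N}^I}\mathfrak{S}^{(n)}_{\underline{k}}$. *)

(* Defs.v *)
From HB Require Import structures.
From mathcomp Require Import all_boot all_order all_algebra all_fingroup.
From mathcomp Require Import mpoly complex.
From mathcomp Require Import boolp classical_sets reals.

Set Implicit Arguments.
Unset Strict Implicit.
Unset Printing Implicit Defensive.

Import GRing.Theory.
Local Open Scope ring_scope.

Local Notation "x %:F" := (tofrac x).

Section RationalFunctions.
Variable K : fieldType.

Definition ratfun (T : finType) : fieldType := {fraction {mpoly K[#|T|]}}.

Definition rvar (T : finType) (t : T) : ratfun T := ('X_(enum_rank t))%:F.

Definition rconst (T : finType) (c : K) : ratfun T := (c%:MP)%:F.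

Definition peval (T T' : finType) (u : T -> ratfun T')
    (p : {mpoly K[#|T|]}) : ratfun T' :=
  mmap (@rconst T') (fun i => u (enum_val i)) p.

(* F(u), for a rational function F regular at the point u: it is p(u) / q(u)
   for any presentation F = p / q with q(u) != 0, see subst_frac below.
   The value is 0 by convention when there is no such presentation. *)
Definition subst (T T' : finType) (u : T -> ratfun T') (F : ratfun T) :
    ratfun T' :=
  xget 0 [set w | exists p q : {mpoly K[#|T|]},
    [/\ peval u q != 0, F = p%:F / q%:F & w = peval u p / peval u q]]%classic.

(* Laurent polynomials all of whose coefficients satisfy S. *)
Definition laurent (S : K -> Prop) (T : finType) (F : ratfun T) : Prop :=
  exists (p : {mpoly K[#|T|]}) (m : 'X_{1..#|T|}),
    (forall m', S p@_m') /\ F = p%:F / ('X_[m])%:F.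

Lemma peval_rmorph (T T' : finType) (u : T -> ratfun T') :
  {f : {rmorphism {mpoly K[#|T|]} -> ratfun T'} | forall p, peval u p = f p}.
Proof.
pose f : {rmorphism K -> ratfun T'} := (@tofrac _) \o (@mpolyC _ K).
by exists (mmap f (fun i => u (enum_val i))).
Qed.

Lemma subst_frac (T T' : finType) (u : T -> ratfun T') p q :
  peval u q != 0 -> subst u (p%:F / q%:F) = peval u p / peval u q.
Proof.
move=> q_neq0; rewrite /subst.
have nz r : peval u r != 0 -> (r%:F : ratfun T) != 0.
  rewrite tofrac_eq0; apply: contra => /eqP->.
  by case: (peval_rmorph u) => f ->; rewrite rmorph0.
apply: (@xget_subset1 _ 0 [set w | _]%classic); first by exists p, q.
move=> _ _ [p1 [q1 [q1n e1 ->]]] [p2 [q2 [q2n e2 ->]]].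
have /eqP := e1; rewrite e2 eqr_div ?nz // -!tofracM tofrac_eq => /eqP e.
apply/eqP; rewrite eqr_div //; move: e.
by case: (peval_rmorph u) => f E; rewrite !E -!rmorphM => ->.
Qed.

End RationalFunctions.

(* Cv is the field C(v) and Zv its subring C[v, v^-1]. *)
Section GroundField.
Variable C : fieldType.

Definition Cv : fieldType := {fraction {poly C}}.

Definition v : Cv := ('X)%:F.

Definition Zv (c : Cv) : Prop :=
  exists (p : {poly C}) (m : nat), c = p%:F / v ^+ m.

Definition qint (k : nat) : Cv := (v ^+ k - v ^- k) / (v - v^-1).

Definition qfact (k : nat) : Cv := \prod_(1 <= i < k.+1) qint i.

End GroundField.
Arguments v {C}.
Arguments qint {C} k.
Arguments qfact {C} k.

(* The set I = {1, ..., n-1} is represented by 'I_n.-1, the ordinal i standing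
   for the element i + 1 of I. *)
Section Combinatorics.
Variable n : nat.
Local Notation I := 'I_n.-1.

(* The positive root alpha_j + ... + alpha_i is represented by (j, i). *)
Definition posroot := {b : I * I | (b.1 <= b.2)%N}.

Definition jroot (b : posroot) : I := (val b).1.
Definition iroot (b : posroot) : I := (val b).2.
Definition rsupp (b : posroot) : {set I} :=
  [set i : I | (jroot b <= i <= iroot b)%N].

Definition alpha (i : I) : 'rV[int]_n.-1 := delta_mx 0 i.
Definition rootvec (b : posroot) : 'rV[int]_n.-1 := \sum_(i in rsupp b) alpha i.

Definition root_lt (b b' : posroot) : bool :=
  (jroot b < jroot b')%N || (jroot b == jroot b') && (iroot b < iroot b')%N.

Definition degree := {ffun I -> nat}.

Definition xvar (k : degree) : finType := {i : I & 'I_(k i)}.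
Definition xv (k : degree) (i : I) (r : 'I_(k i)) : xvar k :=
  Tagged (fun i => 'I_(k i)) r.

Definition yvar (d : posroot -> nat) : finType := {b : posroot & 'I_(d b)}.

Definition yvar_lt (d : posroot -> nat) (a b : yvar d) : bool :=
  root_lt (tag a) (tag b) ||
  (tag a == tag b) && (nat_of_ord (tagged a) < nat_of_ord (tagged b))%N.

Definition zvar (l : posroot -> nat) : finType := {b : posroot & 'I_(l b)}.
Definition zv (l : posroot -> nat) (b : posroot) (r : 'I_(l b)) : zvar l :=
  Tagged (fun b => 'I_(l b)) r.

Definition has_weight (d : posroot -> nat) (k : degree) : Prop :=
  \sum_(b : posroot) rootvec b *+ d b = \sum_(i : I) alpha i *+ k i.

(* sg sends each x-variable to the index (beta, s) of its group. *)
Definition splitting (k : degree) (d : posroot -> nat)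
    (sg : xvar k -> yvar d) : Prop :=
  (forall a, tag a \in rsupp (tag (sg a))) /\
  (forall (b : yvar d) (i : I), i \in rsupp (tag b) ->
     exists! r : 'I_(k i), sg (xv r) = b).

(* Position p (counted from 0) in the r-th group attached to beta; that group
   has size t beta r. *)
Definition slot (l : posroot -> nat) (t : forall b, 'I_(l b) -> nat) : finType :=
  {z : zvar l & 'I_(t (tag z) (tagged z))}.

Definition grouping (d l : posroot -> nat) (t : forall b, 'I_(l b) -> nat)
    (tau : yvar d -> slot t) : Prop :=
  bijective tau /\ (forall a, tag (tag (tau a)) = tag a).

(* The next two lemmas show that quantifying over all splittings and groupings
   is never vacuous. *)
Lemma splitting_exists (k : degree) (d : posroot -> nat) :
  has_weight d k -> exists sg : xvar k -> yvar d, splitting sg.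
Proof.
move=> hw.
pose A i := [set b : yvar d | i \in rsupp (tag b)].
have cardA i : k i = #|A i|.
  have := congr1 (fun M : 'rV[int]_n.-1 => M 0 i) hw.
  rewrite !summxE [RHS](bigD1 i) //= [X in _ + X]big1 => [|j ji]; last first.
    by rewrite mulmxnE /alpha mxE eq_sym (negPf ji) andbF mul0rn.
  rewrite addr0 mulmxnE /alpha mxE !eqxx => e.
  have ek : (\sum_(b : posroot) (i \in rsupp b) * d b)%N = k i.
    apply/eqP; rewrite -(Num.Theory.eqr_nat int) natr_sum -e; apply/eqP.
    apply: eq_bigr => b _; rewrite mulmxnE summxE natrM -[RHS]mulr_natr; congr (_ * _).
    case: (boolP (i \in rsupp b)) => ib.
      rewrite (bigD1 i) //= big1 ?addr0 /alpha ?mxE ?eqxx // => j /andP[_ ji].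
      by rewrite /alpha mxE eq_sym (negPf ji) andbF.
    rewrite big1 // => j jb; rewrite /alpha mxE eqxx /=.
    by case: eqP => // ij; rewrite ij jb in ib.
  rewrite -ek -sum1_card.
  apply: (@etrans _ _ (\sum_(a : yvar d | i \in rsupp (tag a)) 1)%N); last first.
    by apply: eq_bigl => a; rewrite [RHS]inE.
  apply: etrans (sig_big_dep xpredT (fun b (_ : 'I_(d b)) => i \in rsupp b)
                   (fun _ _ => 1%N)).
  apply: eq_bigr => b _; case: (i \in rsupp b); last by rewrite big_pred0.
  by rewrite sum1_card card_ord mul1n.
exists (fun a => enum_val (cast_ord (cardA (tag a)) (tagged a))); split.
  by move=> a; have := enum_valP (cast_ord (cardA (tag a)) (tagged a)); rewrite inE.
move=> b i ib; have bA : b \in A i by rewrite inE.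
exists (cast_ord (esym (cardA i)) (enum_rank_in bA b)); split.
  by rewrite /= cast_ordKV enum_rankK_in.
move=> r /= eb; apply: (@cast_ord_inj _ _ (cardA i)); apply: enum_val_inj.
by rewrite cast_ordKV enum_rankK_in.
Qed.

Lemma grouping_exists (d l : posroot -> nat) (t : forall b, 'I_(l b) -> nat) :
  (forall b, (\sum_(r < l b) t b r = d b)%N) ->
  exists tau : yvar d -> slot t, grouping tau.
Proof.
move=> ht.
pose A b := [set z : slot t | tag (tag z) == b].
have cardA b : d b = #|A b|.
  rewrite -ht -sum1_card.
  apply: (@etrans _ _ (\sum_(z : slot t | tag (tag z) == b) 1)%N); last first.
    by apply: eq_bigl => z; rewrite inE.
  apply: etrans (sig_big_dep xpredT
    (fun z (_ : 'I_(t (tag z) (tagged z))) => tag z == b) (fun _ _ => 1%N)).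
  apply: (@etrans _ _ (\sum_(z : zvar l) (tag z == b) * t (tag z) (tagged z))%N); last first.
    apply: eq_bigr => z _; case: (tag z == b); last by rewrite big_pred0.
    by rewrite sum1_card card_ord mul1n.
  apply: etrans (sig_big_dep xpredT (fun c (_ : 'I_(l c)) => true)
             (fun c r => (c == b) * t c r)%N).
  rewrite (bigD1 b) //= [X in (_ + X)%N]big1 ?addn0.
    by apply: eq_bigr => r _; rewrite eqxx mul1n.
  by move=> c /negPf cb; rewrite big1 // => r _; rewrite cb.
pose tau (a : yvar d) : slot t := enum_val (cast_ord (cardA (tag a)) (tagged a)).
have tagtau a : tag (tag (tau a)) = tag a.
  have := enum_valP (cast_ord (cardA (tag a)) (tagged a)).
  by rewrite inE => /eqP.
exists tau; split=> //.
have tauA (z : slot t) : z \in A (tag (tag z)) by rewrite inE.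
exists (fun z : slot t => Tagged (fun b => 'I_(d b))
   (cast_ord (esym (cardA _)) (enum_rank_in (tauA z) z))).
  move=> a; have tauK z (e : tag (tag z) = tag a) : z = tau a ->
    Tagged (fun b => 'I_(d b))
      (cast_ord (esym (cardA _)) (enum_rank_in (tauA z) z)) = a.
    case: a e => b r /= e; subst b => ez; congr (Tagged _ _).
    apply: (@cast_ord_inj _ _ (cardA _)); apply: enum_val_inj.
    by rewrite cast_ordKV enum_rankK_in.
  exact: tauK (tagtau a) _.
by move=> z; rewrite /tau /= cast_ordKV enum_rankK_in.
Qed.

Definition adj (i j : I) : bool := (j == i.+1 :> nat) || (i == j.+1 :> nat).

End Combinatorics.

Section ShuffleAlgebra.
Variables (C : fieldType) (n : nat).
Local Notation I := 'I_n.-1.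
Local Notation K := (Cv C).

Definition rf (k : degree n) : fieldType := ratfun K (xvar k).

Definition X (k : degree n) (i : I) (r : 'I_(k i)) : rf k := rvar K (xv r).

Definition total (k : degree n) : nat := \sum_(i : I) k i.

Definition symmetric_rf (k : degree n) (F : rf k) : Prop :=
  forall s : (forall i : I, 'S_(k i)),
    subst (fun a : xvar k => X (s (tag a) (tagged a))) F = F.

Definition poles (k : degree n) : rf k :=
  \prod_(i : I) \prod_(j : I | j == i.+1 :> nat)
    \prod_(r < k i) \prod_(r' < k j) (X r - X r').

(* The point x_{j,s} = v^-1 x_{i,r1}, x_{i,r2} = v^-2 x_{i,r1}, all the other
   variables being generic. *)
Definition wheel_point (k : degree n) (i j : I) (r1 r2 : 'I_(k i))
    (s : 'I_(k j)) (a : xvar k) : rf k :=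
  if a == xv s then rconst _ v^-1 * X r1
  else if a == xv r2 then rconst _ (v ^- 2) * X r1
  else rvar K a.

Definition wheel (k : degree n) (F : rf k) : Prop :=
  forall (i j : I) (r1 r2 : 'I_(k i)) (s : 'I_(k j)),
    adj i j -> r1 != r2 -> subst (wheel_point r1 r2 s) F = 0.

Definition inS (k : degree n) (F : rf k) : Prop :=
  [/\ symmetric_rf F,
      exists f : rf k,
        [/\ laurent (fun=> True) f, symmetric_rf f & F = f / poles k]
    & wheel F].

Definition numer (k : degree n) (F : rf k) : rf k := F * poles k.

Definition in_tildeS (k : degree n) (F : rf k) : Prop :=
  inS F /\
  exists g : rf k,
    [/\ laurent (@Zv C) g, symmetric_rf g
      & numer F = rconst _ ((v - v^-1) ^+ total k) * g].

Section Specialization.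
Variables (k : degree n) (d : posroot n -> nat).

Definition Y (a : yvar d) : ratfun K (yvar d) := rvar K a.

Definition phi (sg : xvar k -> yvar d) (F : rf k) : ratfun K (yvar d) :=
  subst (fun a : xvar k => rconst _ (v ^- (tag a).+1) * Y (sg a)) (numer F).

Definition Afactor : ratfun K (yvar d) := rconst _ ((v - v^-1) ^+ total k).

Definition Bfactor : ratfun K (yvar d) :=
  \prod_(a : yvar d) \prod_(b : yvar d | yvar_lt a b)
    ((Y a - rconst _ (v ^- 2) * Y b) ^+
        (#|[set p in finset.setX (rsupp (tag a)) (rsupp (tag b)) |
             p.1 == p.2]| - (tag a == tag b)) *
     (Y a - rconst _ (v ^+ 2) * Y b) ^+
        #|[set p in finset.setX (rsupp (tag a)) (rsupp (tag b)) |
             p.1 == p.2.+1 :> nat]|).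

Definition varphi (sg : xvar k -> yvar d) (F : rf k) : ratfun K (yvar d) :=
  phi sg F / (Afactor * Bfactor).

Definition Upsilon (l : posroot n -> nat) (t : forall b, 'I_(l b) -> nat)
    (sg : xvar k -> yvar d) (tau : yvar d -> slot t) (F : rf k) :
    ratfun K (zvar l) :=
  subst (fun a : yvar d =>
           rconst _ (v ^- (2 * (tagged (tau a)).+1)) * rvar K (tag (tau a)))
        (varphi sg F).

End Specialization.

(* phi and Upsilon do not depend on the splittings sg and tau, over which we
   quantify universally. That varphi sg F lies in C[v,v^-1][y^{+-1}] is part of
   the construction of Upsilon (it follows from the wheel conditions). *)
Definition integral (k : degree n) (F : rf k) : Prop :=
  in_tildeS F /\
  forall (d : posroot n -> nat) (sg : xvar k -> yvar d),
    has_weight d k -> splitting sg ->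
    laurent (@Zv C) (varphi sg F) /\
    forall (l : posroot n -> nat) (t : forall b, 'I_(l b) -> nat)
           (tau : yvar d -> slot t),
      (forall b r, (0 < t b r)%N) ->
      (forall b, (\sum_(r < l b) t b r = d b)%N) ->
      grouping tau ->
      exists2 H : ratfun K (zvar l), laurent (@Zv C) H &
        Upsilon sg tau F =
          rconst _ (\prod_(b : posroot n) \prod_(r < l b) qfact (t b r)) * H.

Definition graded : Type := forall k : degree n, rf k.

Definition in_dsum (P : forall k : degree n, rf k -> Prop) (F : graded) : Prop :=
  (exists s : seq (degree n), forall k, k \notin s -> F k = 0) /\
  (forall k, P k (F k)).

Definition inSn : graded -> Prop := in_dsum inS.
Definition integral_n : graded -> Prop := in_dsum integral.

Definition iota' (l : I) (F : graded) : graded :=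
  fun k => (\prod_(r < k l) (1 - (X r)^-1)) * F k.

Definition int_symmetric (m : nat) (g : ratfun K 'I_m) : Prop :=
  laurent (@Zv C) g /\
  (forall s : 'S_m, subst (fun r : 'I_m => rvar K (s r)) g = g).

Definition elementF (k : degree n) (g : forall i : I, ratfun K 'I_(k i)) : rf k :=
  rconst _ ((v - v^-1) ^+ total k) *
  ((\prod_(i : I) \prod_(r < k i) \prod_(r' < k i | r != r')
      (X r - rconst _ (v ^- 2) * X r')) *
   (\prod_(i : I) subst (fun r : 'I_(k i) => X r) (g i))) /
  poles k.

End ShuffleAlgebra.

(* Main.v *)
Require Import Defs.
From mathcomp Require Import all_boot all_order all_algebra all_fingroup.
From mathcomp Require Import mpoly complex reals.
From mathcomp Require Import zify.

Set Implicit Arguments.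
Unset Strict Implicit.
Unset Printing Implicit Defensive.

Import GRing.Theory.
Local Open Scope ring_scope.

(** Part (a). Let P be the product of the factors 1 - 1/x over the variables
x of colour l. Every specialization in the definition of integrality is a ring
morphism where it is defined, and it sends a factor 1 - 1/x to 1 - c/y with c
a power of v. Hence phi, varphi and Upsilon of P F are phi, varphi and Upsilon
of F multiplied by such factors ([phi_iota], [varphi_iota], [Upsilon_iota]),
which settles one implication, and the other one consists in cancelling them.
Such a factor is primitive: if h is a Laurent polynomial over the whole field
C(v), and (1 - c/y) h has coefficients in C[v,v^-1], then so has h
([laurent_division]). This recovers the integrality of the numerator of F and,
after division by the quantum factorials, that of Upsilon. For varphi one also
has to know that varphi(F) has no pole. It could only have poles along the
factors y - c' y' of B, because B varphi(F) is phi(F) up to a scalar; as such a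
factor is coprime to every 1 - c/y ([coprime_vardiff_linfac]), these poles
would survive in varphi(P F).

Part (b). Write D(a, b) = y_a - v^-2 y_b, where a and b run over the pairs
(beta, s). After the substitution phi, the product of the factors
x_{i,r} - v^-2 x_{i,r'} becomes, up to a unit, the product over all a <> b of
D(a, b) to the power c(a, b), the number of colours common to a and b
([phi_zeta_offdiag]). Since D(b, a) is y_a - v^2 y_b up to a unit, this is the
product over a < b of (y_a - v^-2 y_b)^c (y_a - v^2 y_b)^c. The exponents in B
are c - delta and e, where e counts the pairs of colours that differ by one;
e <= c holds when a < b, strictly if a and b have the same root
([shift_subset], [shift_proper]). So B divides phi(F) with coefficients in
C[v,v^-1], and for a < b with the same root the quotient still contains
(y_a - v^-2 y_b)(y_a - v^2 y_b). One of these factors vanishes as soon as two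
consecutive points of the same string v^-2 z, v^-4 z, ... are substituted for
y_a and y_b ([cofactor_vanishes]). Therefore Upsilon(F) = 0 unless all the
strings have length one, and in that case the quantum factorials are all 1. *)

(** * Specialization of rational functions *)

Section Specialization.
Variable K : fieldType.
Implicit Types T : finType.

Lemma rconst_rmorph T :
  {f : {rmorphism K -> ratfun K T} | forall c, rconst T c = f c}.
Proof.
pose f : {rmorphism K -> ratfun K T} := (@tofrac _) \o (@mpolyC _ K).
by exists f.
Qed.

Lemma rconst0 T : rconst T (0 : K) = 0.
Proof. by case: (rconst_rmorph T) => f ->; rewrite rmorph0. Qed.

Lemma rconst1 T : rconst T (1 : K) = 1.
Proof. by case: (rconst_rmorph T) => f ->; rewrite rmorph1. Qed.

Lemma rconstM T (a b : K) : rconst T (a * b) = rconst T a * rconst T b.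
Proof. by case: (rconst_rmorph T) => f E; rewrite !E rmorphM. Qed.

Lemma rconstB T (a b : K) : rconst T (a - b) = rconst T a - rconst T b.
Proof. by case: (rconst_rmorph T) => f E; rewrite !E rmorphB. Qed.

Lemma rconstV T (a : K) : rconst T a^-1 = (rconst T a)^-1.
Proof. by case: (rconst_rmorph T) => f E; rewrite !E fmorphV. Qed.

Lemma rconst_eq0 T (a : K) : (rconst T a == 0) = (a == 0).
Proof. by case: (rconst_rmorph T) => f E; rewrite E fmorph_eq0. Qed.

Lemma pevalC T T' (u : T -> ratfun K T') (c : K) :
  peval u c%:MP = rconst T' c.
Proof.
pose f : {rmorphism K -> ratfun K T'} := (@tofrac _) \o (@mpolyC _ K).
exact: (mmapC (fun i => u (enum_val i)) f).
Qed.

Lemma pevalX T T' (u : T -> ratfun K T') m :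
  peval u 'X_[m] = \prod_i u (enum_val i) ^+ m i.
Proof.
pose f : {rmorphism K -> ratfun K T'} := (@tofrac _) \o (@mpolyC _ K).
exact: (mmapX (fun i => u (enum_val i)) f).
Qed.

Lemma peval_var T T' (u : T -> ratfun K T') t :
  peval u 'X_(enum_rank t) = u t.
Proof.
rewrite pevalX (bigD1 (enum_rank t)) //= mnmE eqxx enum_rankK.
rewrite big1 ?mulr1 ?expr1 // => i /negPf ne.
by rewrite mnmE eq_sym ne expr0.
Qed.

Lemma tofrac_peval T (p : {mpoly K[#|T|]}) :
  tofrac p = peval (@rvar K T) p.
Proof.
rewrite {1}[p]mpolyE rmorph_sum; apply: eq_bigr => m _.
rewrite -mul_mpolyC rmorphM; congr (_ * _).
rewrite [in LHS]mpolyXE_id rmorph_prod; apply: eq_bigr => i _.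
by rewrite rmorphXn /rvar enum_valK.
Qed.

(** The graph of [subst u], restricted to the functions that are regular at
[u]: unlike the total function [subst], this relation is compatible with all
the field operations. *)
Definition spec T T' (u : T -> ratfun K T') (F : ratfun K T)
    (w : ratfun K T') : Prop :=
  exists p q : {mpoly K[#|T|]},
    [/\ peval u q != 0, F = tofrac p / tofrac q & w = peval u p / peval u q].

Section Spec.
Variables (T T' : finType) (u : T -> ratfun K T').
Implicit Types (F G : ratfun K T) (w : ratfun K T').

Lemma peval_neq0 p : peval u p != 0 -> (tofrac p : ratfun K T) != 0.
Proof.
rewrite tofrac_eq0; apply: contra => /eqP->.
by case: (peval_rmorph u) => f ->; rewrite rmorph0.
Qed.

Lemma spec_subst F w : spec u F w -> subst u F = w.
Proof. by case=> p [q [qn -> ->]]; rewrite subst_frac. Qed.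

Lemma spec_regular F w : spec u F w -> spec u F (subst u F).
Proof. by move=> h; rewrite (spec_subst h). Qed.

Lemma spec_poly p : spec u (tofrac p) (peval u p).
Proof.
have e1 : peval u 1 = 1 by case: (peval_rmorph u) => f ->; rewrite rmorph1.
by exists p, 1; rewrite e1 oner_neq0 rmorph1 !divr1.
Qed.

Lemma spec_const c : spec u (rconst T c) (rconst T' c).
Proof. by have := spec_poly c%:MP; rewrite pevalC. Qed.

Lemma spec_var t : spec u (rvar K t) (u t).
Proof. by have := spec_poly 'X_(enum_rank t); rewrite peval_var. Qed.

Lemma spec0 : spec u 0 0.
Proof. by have := spec_const 0; rewrite !rconst0. Qed.

Lemma spec1 : spec u 1 1.
Proof. by have := spec_const 1; rewrite !rconst1. Qed.

Lemma specM F G w w' : spec u F w -> spec u G w' -> spec u (F * G) (w * w').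
Proof.
move=> [p [q [qn -> ->]]] [p' [q' [qn' -> ->]]]; exists (p * p'), (q * q').
case: (peval_rmorph u) => f E; rewrite !E in qn qn' *.
split.
- by rewrite (rmorphM f); exact: (mulf_neq0 qn qn').
- by rewrite !tofracM; exact: mulf_div.
- by rewrite !(rmorphM f); exact: mulf_div.
Qed.

Lemma specD F G w w' : spec u F w -> spec u G w' -> spec u (F + G) (w + w').
Proof.
move=> [p [q [qn -> ->]]] [p' [q' [qn' -> ->]]].
exists (p * q' + p' * q), (q * q').
have tq := peval_neq0 qn; have tq' := peval_neq0 qn'.
case: (peval_rmorph u) => f E; rewrite !E in qn qn' *; split.
- by rewrite (rmorphM f); exact: (mulf_neq0 qn qn').
- by rewrite tofracD !tofracM; exact: addf_div.
- by rewrite (rmorphD f) !(rmorphM f); exact: addf_div.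
Qed.

Lemma specV F w : w != 0 -> spec u F w -> spec u F^-1 w^-1.
Proof.
move=> wn [p [q [qn -> ew]]]; rewrite ew in wn *; exists q, p; split.
- by apply: contraNneq wn => ->; rewrite mul0r.
- exact: (invf_div (tofrac p) (tofrac q)).
- exact: (invf_div (peval u p) (peval u q)).
Qed.

Lemma specB F G w w' : spec u F w -> spec u G w' -> spec u (F - G) (w - w').
Proof.
move=> sF sG; apply: specD => //; rewrite -mulN1r -[- w']mulN1r.
apply: specM => //; have := specD (spec_const (-1)) spec0; rewrite !addr0.
by case: (rconst_rmorph T) => f ->; case: (rconst_rmorph T') => g ->; rewrite !rmorphN1.
Qed.

Lemma spec_exp F w k : spec u F w -> spec u (F ^+ k) (w ^+ k).
Proof.
by move=> s; elim: k => [|k IH]; [exact: spec1 | rewrite !exprS; exact: specM].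
Qed.

Lemma spec_prod J (r : seq J) (P : pred J) (F : J -> ratfun K T)
    (w : J -> ratfun K T') :
  (forall j, P j -> spec u (F j) (w j)) ->
  spec u (\prod_(j <- r | P j) F j) (\prod_(j <- r | P j) w j).
Proof.
move=> h; apply: (big_ind2 (spec u)); [exact: spec1 | | exact: h].
by move=> x1 x2 y1 y2; exact: specM.
Qed.

Lemma spec_sum J (r : seq J) (P : pred J) (F : J -> ratfun K T)
    (w : J -> ratfun K T') :
  (forall j, P j -> spec u (F j) (w j)) ->
  spec u (\sum_(j <- r | P j) F j) (\sum_(j <- r | P j) w j).
Proof.
move=> h; apply: (big_ind2 (spec u)); [exact: spec0 | | exact: h].
by move=> x1 x2 y1 y2; exact: specD.
Qed.

(** The standard way below of showing that an explicit function is not zero. *)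
Lemma spec_neq0 F w : w != 0 -> spec u F w -> F != 0.
Proof.
move=> wn s; apply: contra_neq wn => F0.
by rewrite -(spec_subst s) F0 (spec_subst spec0).
Qed.

End Spec.

(** Substitutions compose: only the composite [u''] has to be regular on [F],
for if a denominator vanished at [u], it would also vanish at [u'']. *)
Lemma spec_comp T T' T'' (u : T -> ratfun K T') (u' : T' -> ratfun K T'')
    (u'' : T -> ratfun K T'') F w :
  (forall t, spec u' (u t) (u'' t)) -> spec u'' F w -> spec u' (subst u F) w.
Proof.
move=> su [p [q [qn -> ->]]].
have sp r : spec u' (peval u r) (peval u'' r).
  apply: spec_sum => m _; apply: specM; first exact: spec_const.
  by apply: spec_prod => i _; apply: spec_exp.
have qn' := spec_neq0 qn (sp q).
rewrite subst_frac //; apply: specM (sp p) _; exact: specV (sp q).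
Qed.

End Specialization.

(** * Laurent polynomials with coefficients in a subring *)

Section Laurent.
Variable K : fieldType.
Implicit Types T : finType.

Definition subring_pred (S : K -> Prop) : Prop :=
  [/\ S 1, forall a b, S a -> S b -> S (a - b) & forall a b, S a -> S b -> S (a * b)].

Definition allK : K -> Prop := fun=> True.

Lemma allK_subring : subring_pred allK.
Proof. by []. Qed.

Section Closure.
Variable S : K -> Prop.
Hypothesis hS : subring_pred S.

Lemma subring1 : S 1.
Proof. by case: hS. Qed.

Lemma subring0 : S 0.
Proof. by case: hS => h1 hB _; rewrite -(subrr 1); exact: hB. Qed.

Lemma subringN a : S a -> S (- a).
Proof. by move=> ha; case: hS => h1 hB _; rewrite -sub0r; apply: hB ha; exact: subring0. Qed.

Lemma subringD a b : S a -> S b -> S (a + b).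
Proof.
by move=> ha hb; case: hS => _ hB _; rewrite -[b]opprK; apply: hB => //; exact: subringN.
Qed.

Lemma subringM a b : S a -> S b -> S (a * b).
Proof. by case: hS => _ _; apply. Qed.

Section OneType.
Variable T : finType.
Local Notation L := (@laurent K S T).
Implicit Types F G : ratfun K T.

Lemma mon_neq0 (m : 'X_{1..#|T|}) : (tofrac ('X_[m] : {mpoly K[#|T|]}) : ratfun K T) != 0.
Proof.
rewrite tofrac_eq0; apply/eqP => /(congr1 (fun p => p@_m)) /eqP.
by rewrite mcoeffX eqxx mcoeff0 oner_eq0.
Qed.

Lemma laurent_poly (p : {mpoly K[#|T|]}) : (forall m, S p@_m) -> L (tofrac p).
Proof. by move=> hp; exists p, 0%MM; split=> //; rewrite mpolyX0 rmorph1 divr1. Qed.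

Lemma laurent_const c : S c -> L (rconst T c).
Proof.
move=> hc; apply: laurent_poly => m; rewrite mcoeffC.
by case: (m == _); rewrite ?mulr1 ?mulr0 //; exact: subring0.
Qed.

Lemma laurent_var t : L (rvar K t).
Proof.
apply: laurent_poly => m; rewrite mcoeffX; case: (_ == _); first by case: hS.
exact: subring0.
Qed.

Lemma laurentM F G : L F -> L G -> L (F * G).
Proof.
move=> [p [m [hp ->]]] [q [m' [hq ->]]]; exists (p * q), (m + m')%MM; split.
  move=> k; rewrite mcoeffM; apply: (big_ind S); [exact: subring0 | exact: subringD |].
  by move=> i _; exact: subringM.
by rewrite mpolyXD !rmorphM mulf_div.
Qed.

Lemma laurentD F G : L F -> L G -> L (F + G).
Proof.
have mX p m k : (forall m', S p@_m') -> S (p * 'X_[m] : {mpoly K[#|T|]})@_k.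
  move=> hp; rewrite mcoeffM; apply: (big_ind S); [exact: subring0 | exact: subringD |].
  move=> i _; apply: subringM => //; rewrite mcoeffX; case: (_ == _); first by case: hS.
  exact: subring0.
move=> [p [m [hp ->]]] [q [m' [hq ->]]].
exists (p * 'X_[m'] + q * 'X_[m]), (m + m')%MM; split.
  by move=> k; rewrite mcoeffD; apply: subringD; apply: mX.
by rewrite mpolyXD rmorphD !rmorphM addf_div ?mon_neq0.
Qed.

Lemma laurent0 : L 0.
Proof. by rewrite -(rconst0 K T); apply: laurent_const; exact: subring0. Qed.

Lemma laurent1 : L 1.
Proof. by rewrite -(rconst1 K T); apply: laurent_const; case: hS. Qed.

Lemma laurentB F G : L F -> L G -> L (F - G).
Proof.
move=> hF hG; apply: laurentD => //; rewrite -mulN1r; apply: laurentM => //.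
have: L (rconst T (-1)) by apply/laurent_const/subringN; case: hS.
by case: (rconst_rmorph K T) => f ->; rewrite rmorphN1.
Qed.

Lemma laurent_varV t : L (rvar K t)^-1.
Proof.
exists 1, U_(enum_rank t)%MM; split; last by rewrite rmorph1 mul1r.
by move=> m; rewrite mcoeff1; case: (m == _); [case: hS | exact: subring0].
Qed.

Lemma laurent_exp F k : L F -> L (F ^+ k).
Proof.
by move=> h; elim: k => [|k IH]; [exact: laurent1 | rewrite exprS; exact: laurentM].
Qed.

Lemma laurent_prod J (r : seq J) (P : pred J) (F : J -> ratfun K T) :
  (forall j, P j -> L (F j)) -> L (\prod_(j <- r | P j) F j).
Proof. by move=> h; apply: big_ind => //; [exact: laurent1 | exact: laurentM]. Qed.

Lemma laurent_sum J (r : seq J) (P : pred J) (F : J -> ratfun K T) :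
  (forall j, P j -> L (F j)) -> L (\sum_(j <- r | P j) F j).
Proof. by move=> h; apply: big_ind => //; [exact: laurent0 | exact: laurentD]. Qed.

(* Otherwise unification unfolds the construction of the fraction field. *)
#[local] Opaque ratfun.

(** The units of the Laurent polynomial ring over S, used as admissible points
of substitution. *)
Definition munit F : Prop := [/\ F != 0, L F & L F^-1].

Lemma munit1 : munit 1.
Proof. by split; rewrite ?oner_neq0 ?invr1 //; exact: laurent1. Qed.

Lemma munitM F G : munit F -> munit G -> munit (F * G).
Proof.
move=> [nF lF lF'] [nG lG lG']; rewrite /munit invfM; split.
- exact: (mulf_neq0 nF nG).
- exact: (laurentM lF lG).
- exact: (laurentM lF' lG').
Qed.

Lemma munitV F : munit F -> munit F^-1.
Proof. by move=> [nF lF lF']; split; rewrite ?invr_eq0 ?invrK. Qed.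

Lemma rvar_neq0 t : rvar K t != 0 :> ratfun K T.
Proof. exact: mon_neq0. Qed.

Lemma munit_var t : munit (rvar K t).
Proof. by split; [exact: rvar_neq0 | exact: laurent_var | exact: laurent_varV]. Qed.

Lemma munit_const c : c != 0 -> S c -> S c^-1 -> munit (rconst T c).
Proof.
move=> cn hc hc'; split; rewrite ?rconst_eq0 // -?rconstV; exact: laurent_const.
Qed.

End OneType.

(** At a point whose coordinates are units, the denominator of a Laurent
polynomial, a monomial, specializes to a unit. *)
Lemma laurent_spec T T' (u : T -> ratfun K T') F :
  (forall t, munit (u t)) -> laurent S F -> laurent S (subst u F).
Proof.
move=> hu [p [m [hp ->]]].
have un : peval u 'X_[m] != 0.
  by rewrite pevalX; apply/prodf_neq0 => i _; apply: expf_neq0; case: (hu (enum_val i)).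
rewrite subst_frac //; apply: laurentM.
  apply: laurent_sum => k _; apply: laurentM; first exact: laurent_const.
  by apply: laurent_prod => i _; apply: laurent_exp; case: (hu (enum_val i)).
rewrite pevalX -prodfV; apply: laurent_prod => i _; rewrite -exprVn.
by apply: laurent_exp; case: (hu (enum_val i)).
Qed.

Lemma laurent_regular T T' (u : T -> ratfun K T') F :
  (forall t, u t != 0) -> laurent S F -> spec u F (subst u F).
Proof.
move=> hu [p [m [hp ->]]]; rewrite subst_frac.
  by exists p, 'X_[m]; split=> //; rewrite pevalX; apply/prodf_neq0 => i _; rewrite expf_neq0.
by rewrite pevalX; apply/prodf_neq0 => i _; rewrite expf_neq0.
Qed.

End Closure.
End Laurent.

(** * Cancelling linear factors in Laurent polynomial rings *)

Section Division.
Variable K : fieldType.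
Implicit Types T : finType.

(** The coefficient of p at k is that of p (X_a - c) at k + U_a, plus c times
that of p at k + U_a: membership in S descends from the monomials of high
degree, where p has no coefficient. *)
Lemma mcoeff_division m (S : K -> Prop) (c : K) (a : 'I_m) (p : {mpoly K[m]}) :
  subring_pred S -> S c ->
  (forall k, S (p * ('X_a - c%:MP))@_k) -> forall k, S p@_k.
Proof.
move=> hS hc hp.
(* Induction on a bound j for how far k lies below the largest degree in p. *)
have step j : forall k, (msize p <= mdeg k + j)%N -> S p@_k.
  elim: j => [|j IH] k hk.
    rewrite memN_msupp_eq0; first exact: subring0.
    by apply/negP => /msize_mdeg_lt; rewrite ltnNge -[mdeg k]addn0 hk.
  have := hp (U_(a) + k)%MM; rewrite mulrBr mcoeffB mcoeffMX mulrC mul_mpolyC mcoeffZ.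
  move=> h; rewrite -[p@_k](subrK (c * p@_(U_(a) + k))); apply: (subringD hS h).
  by apply: (subringM hS hc); apply: IH; rewrite mdegD mdeg1 addnC addnA addn1 addnC.
by move=> k; apply: (step (msize p)); exact: leq_addl.
Qed.

Definition linfac T (c : K) (a : T) : ratfun K T := 1 - (rconst T c) / rvar K a.

Lemma linfac_mul T (c : K) (a : T) :
  linfac c a * rvar K a = rvar K a - rconst T c.
Proof. by rewrite mulrBl mul1r divfK ?rvar_neq0. Qed.

Lemma tofrac_linear T (c : K) (a : T) :
  tofrac ('X_(enum_rank a) - c%:MP) = rvar K a - rconst T c.
Proof. exact: tofracB. Qed.

Lemma laurent_division T (S : K -> Prop) (c : K) (a : T) (h : ratfun K T) :
  subring_pred S -> S c -> laurent (@allK K) h -> laurent S (linfac c a * h) ->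
  laurent S h.
Proof.
move=> hS hc [p [m [_ eh]]] lh.
have : laurent S ((rvar K a - rconst T c) * h).
  by rewrite -linfac_mul mulrAC; exact: (laurentM hS lh (laurent_var hS a)).
move=> [q [m' [hq e]]].
have e2 : (p * 'X_[m']) * ('X_(enum_rank a) - c%:MP) = q * 'X_[m].
  apply/eqP; rewrite -tofrac_eq !tofracM tofrac_linear; apply/eqP.
  have n1 := @mon_neq0 K T m; have n2 := @mon_neq0 K T m'.
  move: e; rewrite eh => /(congr1 (fun z => z * tofrac 'X_[m] * tofrac 'X_[m'])).
  rewrite [in RHS](mulrAC _ (tofrac 'X_[m])) (divfK n2) => <-.
  by rewrite mulrA (divfK n1) mulrC mulrA.
exists (p * 'X_[m']), (m + m')%MM; split.
  apply: (@mcoeff_division _ S c (enum_rank a)) => // k; rewrite e2 mcoeffM.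
  apply: (big_ind S); [exact: subring0 | exact: subringD |] => i _; apply: (subringM hS (hq _)).
  by rewrite mcoeffX; case: (_ == _); [case: hS | exact: subring0].
by rewrite mpolyXD !tofracM eh -mulf_div (divff (mon_neq0 K m')) mulr1.
Qed.

Lemma laurent_weaken T (S : K -> Prop) (F : ratfun K T) :
  laurent S F -> laurent (@allK K) F.
Proof. by case=> p [m [_ ->]]; exists p, m. Qed.

Lemma munit_weaken T (S : K -> Prop) (F : ratfun K T) :
  munit S F -> munit (@allK K) F.
Proof.
case=> n0 l1 l2; split; first exact: n0.
  exact: laurent_weaken l1.
exact: laurent_weaken l2.
Qed.

Definition eval_at T (c : K) (a t : T) : ratfun K T :=
  if t == a then rconst T c else rvar K t.

Lemma munit_constK T (c : K) : c != 0 -> munit (@allK K) (rconst T c).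
Proof. by move=> hc; apply: munit_const. Qed.

Lemma munit_eval_at T (c : K) (a t : T) :
  c != 0 -> munit (@allK K) (eval_at c a t).
Proof.
move=> hc; rewrite /eval_at; case: eqP => _; first exact: munit_constK.
exact: (munit_var (@allK_subring K) t).
Qed.

Section Congruence.
Variables (T : finType) (D : ratfun K T).
Local Notation L := (@laurent K (@allK K) T).
Let hK := @allK_subring K.

Definition congr_mod (x y : ratfun K T) : Prop :=
  [/\ L x, L y & exists2 g, L g & x - y = D * g].

Lemma congr_refl x : L x -> congr_mod x x.
Proof.
by move=> h; split=> //; exists 0; [exact: laurent0 | rewrite subrr mulr0].
Qed.

Lemma congrD x x' y y' :
  congr_mod x x' -> congr_mod y y' -> congr_mod (x + y) (x' + y').
Proof.
move=> [lx lx' [g lg e]] [ly ly' [g' lg' e']]; split; try exact: laurentD.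
exists (g + g'); first exact: laurentD.
by rewrite mulrDr -e -e' opprD addrACA.
Qed.

Lemma congrM x x' y y' :
  congr_mod x x' -> congr_mod y y' -> congr_mod (x * y) (x' * y').
Proof.
move=> [lx lx' [g lg e]] [ly ly' [g' lg' e']]; split; try exact: laurentM.
exists (g * y + x' * g').
  by apply: laurentD => //; exact: laurentM.
by rewrite mulrDr mulrA -e mulrCA -e' mulrBl mulrBr subrKA.
Qed.

Lemma congr_exp x x' k : congr_mod x x' -> congr_mod (x ^+ k) (x' ^+ k).
Proof.
move=> h; elim: k => [|k IH]; last by rewrite !exprS; exact: congrM.
by apply: congr_refl; exact: laurent1.
Qed.

Lemma congr_prod J (r : seq J) (P : pred J) (f g : J -> ratfun K T) :
  (forall j, P j -> congr_mod (f j) (g j)) ->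
  congr_mod (\prod_(j <- r | P j) f j) (\prod_(j <- r | P j) g j).
Proof.
move=> h; apply: (big_ind2 congr_mod); [|by move=> *; exact: congrM | exact: h].
by apply: congr_refl; exact: laurent1.
Qed.

Lemma congr_sum J (r : seq J) (P : pred J) (f g : J -> ratfun K T) :
  (forall j, P j -> congr_mod (f j) (g j)) ->
  congr_mod (\sum_(j <- r | P j) f j) (\sum_(j <- r | P j) g j).
Proof.
move=> h; apply: (big_ind2 congr_mod); [|by move=> *; exact: congrD | exact: h].
by apply: congr_refl; exact: laurent0.
Qed.

End Congruence.

(** A Laurent polynomial is congruent to its value at Y_a = c modulo Y_a - c:
this is true of constants, of the variables and of their inverses, and
congruences can be added and multiplied. The inverse of Y_a is where c must be
nonzero. *)
Lemma laurent_factor T (c : K) (a : T) (F : ratfun K T) :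
  c != 0 -> laurent (@allK K) F -> subst (eval_at c a) F = 0 ->
  exists2 G, laurent (@allK K) G & F = (rvar K a - rconst T c) * G.
Proof.
move=> hc [p [m [_ eF]]].
have hK := @allK_subring K.
pose D := rvar K a - rconst T c.
have lvar t := laurent_var hK t.
have cvar t : congr_mod D (rvar K t) (eval_at c a t).
  rewrite /eval_at; case: eqP => [->|_]; last exact: congr_refl.
  split=> //; first exact: laurent_const.
  by exists 1; [exact: laurent1 | rewrite mulr1].
have cvarV t : congr_mod D (rvar K t)^-1 (eval_at c a t)^-1.
  have [n1 l1 l1'] := munit_var hK t.
  have [n2 l2 l2'] := munit_eval_at a t hc.
  have [_ _ [g lg e]] := cvar t; split=> //.
  (* 1/y - 1/z = - (y - z) / (y z) *)
  exists (- (g / (rvar K t) / (eval_at c a t))).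
    by rewrite -sub0r; apply: laurentB => //; [exact: laurent0 | do 2!apply: laurentM => //].
  rewrite mulrN !mulrA -e mulrBl mulrBl divff // mul1r.
  by rewrite mulrAC divff // mul1r opprB.
have un : peval (eval_at c a) 'X_[m] != 0.
  rewrite pevalX; apply/prodf_neq0 => i _; apply: expf_neq0.
  by case: (munit_eval_at a (enum_val i) hc).
have := subst_frac p un; rewrite -eF => -> w0.
have cp : congr_mod D (tofrac p) (peval (eval_at c a) p).
  rewrite [tofrac p]tofrac_peval; apply: congr_sum => k _; apply: congrM.
    by apply: congr_refl; exact: laurent_const.
  by apply: congr_prod => i _; exact: congr_exp.
have cX : congr_mod D (tofrac 'X_[m])^-1 (peval (eval_at c a) 'X_[m])^-1.
  rewrite [tofrac _]tofrac_peval !pevalX -!prodfV.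
  by apply: congr_prod => i _; rewrite -!exprVn; exact: congr_exp.
have [_ _ [g lg]] := congrM cp cX.
by rewrite w0 subr0 => e; exists g => //; rewrite eF.
Qed.

(** A form of coprimality that can be used on rational functions: a function
that has only poles along b and only poles along w has none. *)
Definition coprime_laurent T (b w : ratfun K T) : Prop :=
  [/\ laurent (@allK K) b, laurent (@allK K) w & forall h,
    laurent (@allK K) (b * h) -> laurent (@allK K) (w * h) ->
    laurent (@allK K) h].

Lemma coprime_laurentC T (b w : ratfun K T) :
  coprime_laurent b w -> coprime_laurent w b.
Proof. by move=> [lb lw hbw]; split=> // h h1 h2; exact: hbw. Qed.

Lemma coprime_laurent1 T (w : ratfun K T) :
  laurent (@allK K) w -> coprime_laurent 1 w.
Proof. by move=> hw; split=> [||h]; rewrite ?mul1r //; exact: laurent1. Qed.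

Lemma coprime_laurentM T (b b' w : ratfun K T) :
  coprime_laurent b w -> coprime_laurent b' w -> coprime_laurent (b * b') w.
Proof.
move=> [lb lw hb] [lb' _ hb']; split=> //; first exact: laurentM.
move=> h; rewrite -mulrA => h1 h2; apply: hb' => //; apply: hb => //.
by rewrite mulrCA; exact: laurentM.
Qed.

Lemma coprime_laurent_prod T J (r : seq J) (P : pred J) (f : J -> ratfun K T) w :
  laurent (@allK K) w -> (forall j, P j -> coprime_laurent (f j) w) ->
  coprime_laurent (\prod_(j <- r | P j) f j) w.
Proof.
move=> lw h; apply: (big_ind (fun b => coprime_laurent b w)) => //.
  exact: coprime_laurent1.
by move=> x y; exact: coprime_laurentM.
Qed.

Lemma coprime_laurent_exp T k (b w : ratfun K T) :
  coprime_laurent b w -> coprime_laurent (b ^+ k) w.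
Proof.
move=> h; elim: k => [|k IH]; last by rewrite exprS; exact: coprime_laurentM.
by apply: coprime_laurent1; case: h.
Qed.

Definition vardiff T (c : K) (e f : T) : ratfun K T :=
  rvar K e - rconst T c * rvar K f.

Lemma laurent_linfac T (S : K -> Prop) (c : K) (a : T) :
  subring_pred S -> S c -> laurent S (linfac c a).
Proof.
move=> hS hc; apply: laurentB => //; first exact: laurent1.
by apply: laurentM => //; [exact: laurent_const | exact: laurent_varV].
Qed.

Lemma laurent_vardiff T (S : K -> Prop) (c : K) (e f : T) :
  subring_pred S -> S c -> laurent S (vardiff c e f).
Proof.
move=> hS hc; apply: laurentB => //; first exact: laurent_var.
by apply: laurentM => //; [exact: laurent_const | exact: laurent_var].
Qed.

Lemma var_sub_const_neq0 T (c : K) (a : T) : rvar K a - rconst T c != 0.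
Proof.
(* The value at Y_a = c + 1 is 1. *)
have s := specB (spec_var (fun _ : T => rconst T (c + 1)) a) (spec_const _ c).
apply: (spec_neq0 _ s); rewrite -rconstB rconst_eq0 addrAC subrr add0r.
exact: oner_neq0.
Qed.

Lemma vardiff_neq0 T (c : K) (e f : T) : e != f -> vardiff c e f != 0.
Proof.
(* The value is 1 when Y_e = 1 and the other variables are 0. *)
move=> ef; pose u t : ratfun K T := rconst T (t == e)%:R.
have s := specB (spec_var u e) (specM (spec_const u c) (spec_var u f)).
apply: (spec_neq0 _ s); rewrite /u eqxx [f == e]eq_sym (negPf ef) /= rconst0 mulr0 subr0.
by rewrite rconst1 oner_neq0.
Qed.

(** Both p1 = b h and p2 = (Y_a - c') h are Laurent polynomials, and
p1 (Y_a - c') = p2 b. At Y_a = c' the left-hand side is 0 while b is not, so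
p2 vanishes there and is divisible by Y_a - c'. *)
Lemma coprime_vardiff_linfac T (c c' : K) (e f a : T) :
  e != f -> c != 0 -> c' != 0 ->
  coprime_laurent (vardiff c e f) (linfac c' a).
Proof.
move=> ef hc hc'; have hK := @allK_subring K; split.
- exact: laurent_vardiff.
- exact: laurent_linfac.
move=> h hb hw.
have D0 := var_sub_const_neq0 c' a.
have hD : laurent (@allK K) ((rvar K a - rconst T c') * h).
  by rewrite -linfac_mul mulrAC; exact: (laurentM hK hw (laurent_var hK a)).
have un t : eval_at c' a t != 0 by case: (munit_eval_at a t hc').
have sD : spec (eval_at c' a) (rvar K a - rconst T c') 0.
  have := specB (spec_var (eval_at c' a) a) (spec_const _ c').
  by rewrite /eval_at eqxx subrr.
have sb := laurent_regular un (laurent_vardiff e f hK (I : allK c)).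
have s1 := specM (laurent_regular un hb) sD.
have s2 := specM (laurent_regular un hD) sb.
(* At most one of the two variables of b is specialized, so b does not vanish. *)
have bn : subst (eval_at c' a) (vardiff c e f) != 0.
  have s := specB (spec_var (eval_at c' a) e)
    (specM (spec_const (eval_at c' a) c) (spec_var (eval_at c' a) f)).
  rewrite (spec_subst s) /eval_at.
  have [ea|ea] := eqVneq e a.
    have [fa|_] := eqVneq f a; first by exfalso; move: ef; rewrite ea fa eqxx.
    have -> : rconst T c' - rconst T c * rvar K f =
        - (rconst T c * (rvar K f - rconst T (c' / c))).
      by rewrite mulrBr -rconstM [c * _]mulrC (divfK hc) opprB.
    have cn : rconst T c != 0 by rewrite rconst_eq0.
    by rewrite oppr_eq0; exact: (mulf_neq0 cn (var_sub_const_neq0 _ f)).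
  have [fa|_] := eqVneq f a; last exact: vardiff_neq0.
  by rewrite -rconstM; exact: var_sub_const_neq0.
have w0 : subst (eval_at c' a) ((rvar K a - rconst T c') * h) = 0.
  apply: (mulIf bn); rewrite mul0r -(spec_subst s2)
    -[RHS](mulr0 (subst (eval_at c' a) (vardiff c e f * h))).
  by rewrite -(spec_subst s1); congr (subst _ _); rewrite mulrAC [RHS]mulrC mulrA mulrAC.
have [G lG eG] := laurent_factor hc' hD w0.
by rewrite (mulfI D0 eG).
Qed.

(** The conclusion of Gauss's lemma for the factor w. *)
Definition primitive T (S : K -> Prop) (w : ratfun K T) : Prop :=
  laurent S w /\ forall h, laurent (@allK K) h -> laurent S (w * h) -> laurent S h.

Lemma primitive_prod T (S : K -> Prop) J (r : seq J) (P : pred J)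
    (f : J -> ratfun K T) :
  subring_pred S -> (forall j, P j -> primitive S (f j)) ->
  primitive S (\prod_(j <- r | P j) f j).
Proof.
move=> hS h; apply: big_ind => //.
  by split=> [|g _]; rewrite ?mul1r //; exact: laurent1.
move=> x y [lx hx] [ly hy]; split=> [|g lg]; first exact: laurentM.
rewrite -mulrA => hxy; apply: hy => //; apply: hx => //.
by apply: (laurentM (@allK_subring K)) => //; exact: laurent_weaken ly.
Qed.

Lemma primitive_linfac T (S : K -> Prop) (c : K) (a : T) :
  subring_pred S -> S c -> primitive S (linfac c a).
Proof.
move=> hS hc; split; first exact: laurent_linfac.
by move=> h; exact: laurent_division.
Qed.

End Division.

(** * The ground field *)

Section GroundField.
Variable C : fieldType.
Local Notation K := (Cv C).
Local Notation v := (@v C).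

Lemma v_neq0 : v != 0.
Proof. by rewrite tofrac_eq0 polyX_eq0. Qed.

Lemma vexp_neq1 k : (0 < k)%N -> v ^+ k != 1.
Proof.
move=> hk; rewrite -tofracXn -tofrac1 tofrac_eq; apply/eqP.
move=> /(congr1 (fun p : {poly C} => size p)).
by rewrite size_polyXn size_poly1 => -[] k0; rewrite k0 in hk.
Qed.

#[local] Opaque Cv.

Lemma vexp_unit k : v ^+ k != 0.
Proof. exact: expf_neq0 _ v_neq0. Qed.

Lemma Zv_subring : subring_pred (@Zv C).
Proof.
split.
- by exists 1, 0%N; rewrite tofrac1 expr0 divr1.
- move=> _ _ [p [m ->]] [q [m' ->]]; exists (p * 'X^m' - q * 'X^m), (m + m')%N.
  rewrite tofracB !tofracM !tofracXn exprD -mulNr addf_div ?vexp_unit //.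
  by rewrite mulNr.
- move=> _ _ [p [m ->]] [q [m' ->]]; exists (p * q), (m + m')%N.
  by rewrite tofracM exprD mulf_div.
Qed.

Lemma Zv_vexp k : Zv (v ^+ k).
Proof. by exists 'X^k, 0%N; rewrite tofracXn expr0 divr1. Qed.

Lemma Zv_vexpV k : Zv (v ^- k).
Proof. by exists 1, k; rewrite tofrac1 mul1r. Qed.

Lemma v_sub_vV_neq0 : v - v^-1 != 0.
Proof.
apply/eqP => /eqP; rewrite subr_eq0 => /eqP /(congr1 ( *%R v)).
by rewrite divff ?v_neq0 // -expr2; apply/eqP; exact: vexp_neq1.
Qed.

Lemma qint_neq0 k : (0 < k)%N -> qint k != 0 :> K.
Proof.
move=> hk; apply: mulf_neq0; last by rewrite invr_eq0; exact: v_sub_vV_neq0.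
apply/eqP => /eqP; rewrite subr_eq0 => /eqP /(congr1 ( *%R (v ^+ k))).
rewrite divff ?vexp_unit // -exprD; apply/eqP; apply: vexp_neq1.
by rewrite addn_gt0 hk.
Qed.

Lemma qfact_neq0 k : qfact k != 0 :> K.
Proof.
rewrite /qfact prodf_seq_neq0; apply/allP => i.
by rewrite mem_index_iota => /andP[h _]; exact: qint_neq0.
Qed.

Lemma qfact1 : qfact 1 = 1 :> K.
Proof. by rewrite /qfact big_nat1 /qint expr1 divff // v_sub_vV_neq0. Qed.

Lemma munit_vexp (T : finType) k : munit (@Zv C) (rconst T (v ^+ k)).
Proof.
by apply: munit_const; [exact: Zv_subring | exact: vexp_unit | exact: Zv_vexp | exact: Zv_vexpV].
Qed.

Lemma munit_vexpV (T : finType) k : munit (@Zv C) (rconst T (v ^- k)).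
Proof. by rewrite rconstV; apply: munitV; exact: munit_vexp. Qed.

End GroundField.

Section Scaling.
Variable K : fieldType.

Lemma rconst_var_inj (T : finType) (c c' : K) (a b : T) : c != 0 ->
  rconst T c * rvar K a = rconst T c' * rvar K b -> a = b /\ c = c'.
Proof.
move=> hc e; have ab : a = b.
  apply/eqP; apply: contraT => ab.
  have := vardiff_neq0 (c' / c) ab.
  rewrite /vardiff [c' / c]mulrC rconstM -mulrA -e mulrA -rconstM mulVf //.
  by rewrite rconst1 mul1r subrr eqxx.
split=> //; move: e; rewrite ab => /(mulIf (rvar_neq0 K b)) e.
by apply/eqP; rewrite -subr_eq0 -(rconst_eq0 T) rconstB e subrr.
Qed.

Lemma spec_linfac (T T' : finType) (u : T -> ratfun K T') (c : K) (a : T) :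
  u a != 0 -> spec u (linfac c a) (1 - rconst T' c / u a).
Proof.
move=> ua; apply: specB; first exact: spec1.
by apply: specM; [exact: spec_const | apply: specV => //; exact: spec_var].
Qed.

Lemma spec_linfac_scaled (T T' : finType) (u : T -> ratfun K T') (c d e : K)
    (a : T) (b : T') :
  d != 0 -> u a = rconst T' d * rvar K b -> d * e = c -> spec u (linfac c a) (linfac e b).
Proof.
move=> hd eu ee; have dn : rconst T' d != 0 by rewrite rconst_eq0.
have ua : u a != 0 by rewrite eu; exact: (mulf_neq0 dn (rvar_neq0 K b)).
have := spec_linfac c ua; rewrite eu -ee rconstM invfM mulrACA (divff dn) mul1r.
by [].
Qed.

End Scaling.

(** * Multiplication by the product of the factors 1 - 1/x *)

Section Multiplication.
Variables (C : fieldType) (n : nat).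
Local Notation I := 'I_n.-1.
Local Notation K := (Cv C).
Local Notation v := (@v C).
#[local] Opaque Cv ratfun.

Section FixedDegree.
Variable k : degree n.
Implicit Types F G : rf C k.

(** The point at which [symmetric_rf] evaluates a function. *)
Definition permpt (s : forall i : I, 'S_(k i)) (a : xvar k) : rf C k :=
  X C (s (tag a) (tagged a)).

(** Symmetry together with regularity, which makes it multiplicative. *)
Definition symspec F : Prop := forall s, spec (permpt s) F F.

Lemma symspec_symmetric F : symspec F -> symmetric_rf F.
Proof. by move=> h s; exact: spec_subst (h s). Qed.

Lemma symspecM F G : symspec F -> symspec G -> symspec (F * G).
Proof. by move=> h1 h2 s; exact: specM. Qed.

Lemma symspecV F : F != 0 -> symspec F -> symspec F^-1.
Proof. by move=> nF h s; exact: specV. Qed.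

Lemma symspec_const c : symspec (rconst _ c).
Proof. by move=> s; exact: spec_const. Qed.

Lemma laurent_symspec (S : K -> Prop) F :
  laurent S F -> symmetric_rf F -> symspec F.
Proof.
move=> lF sF s; rewrite -{2}(sF s); apply: laurent_regular lF => a.
exact: rvar_neq0.
Qed.

Lemma xv_neq (i j : I) (r : 'I_(k i)) (r' : 'I_(k j)) : i != j -> xv r != xv r'.
Proof. by apply: contra => /eqP /(congr1 tag) /= ->. Qed.

Lemma xv_inj (i : I) : injective (@xv n k i).
Proof. by move=> r r' /eqP; rewrite /xv eq_Tagged => /eqP. Qed.

Lemma poles_spec (T' : finType) (u : xvar k -> ratfun K T') :
  spec u (poles C k) (\prod_(i : I) \prod_(j : I | j == i.+1 :> nat)
    \prod_(r < k i) \prod_(r' < k j) (u (xv r) - u (xv r'))).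
Proof. by do 4!(apply: spec_prod => ? _); apply: specB; exact: spec_var. Qed.

Lemma prod_ratfun_neq0 (T J : finType) (P : pred J) (f : J -> ratfun K T) :
  (forall j, P j -> f j != 0) -> \prod_(j | P j) f j != 0.
Proof. by move=> h; apply/prodf_neq0. Qed.

(** This makes elements of S regular at points with distinct nonzero
coordinates, such as the wheel points. *)
Lemma poles_spec_neq0 (T' : finType) (u : xvar k -> ratfun K T') :
  injective u -> exists2 w, w != 0 & spec u (poles C k) w.
Proof.
move=> u_inj; eexists; last exact: poles_spec.
apply: prod_ratfun_neq0 => i _; apply: prod_ratfun_neq0 => j /eqP ij.
apply: prod_ratfun_neq0 => r _; apply: prod_ratfun_neq0 => r' _.
rewrite subr_eq0 (inj_eq u_inj); apply: xv_neq.
by rewrite -val_eqE /= ij ltn_eqF.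
Qed.

Lemma rvar_inj (T : finType) : injective (@rvar K T).
Proof.
move=> a b e; have := @rconst_var_inj K T 1 1 a b (oner_neq0 _).
by rewrite rconst1 !mul1r e => /(_ erefl) [].
Qed.

Lemma poles_neq0 : poles C k != 0.
Proof. by have [w wn /spec_neq0] := poles_spec_neq0 (@rvar_inj (xvar k)); apply. Qed.

Lemma symspec_poles : symspec (poles C k).
Proof.
move=> s; have := poles_spec (permpt s); rewrite {2}/poles.
suff -> : \prod_(i : I) \prod_(j : I | j == i.+1 :> nat) \prod_(r < k i)
   \prod_(r' < k j) (permpt s (xv r) - permpt s (xv r')) = poles C k by [].
apply: eq_bigr => i _; apply: eq_bigr => j _.
rewrite [RHS](reindex_inj (@perm_inj _ (s i))); apply: eq_bigr => r _.
by rewrite [RHS](reindex_inj (@perm_inj _ (s j))).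
Qed.

Lemma inS_symspec F : inS F -> symspec F.
Proof.
case=> _ [f [lf sf ->]] _; apply: symspecM; first exact: laurent_symspec lf sf.
by apply: symspecV; [exact: poles_neq0 | exact: symspec_poles].
Qed.

Lemma inS_regular (T' : finType) (u : xvar k -> ratfun K T') F :
  (forall a, u a != 0) -> injective u -> inS F -> spec u F (subst u F).
Proof.
move=> u0 u_inj [_ [f [lf _ ->]] _]; have [w wn sw] := poles_spec_neq0 u_inj.
have := specM (laurent_regular u0 lf) (specV wn sw).
exact: spec_regular.
Qed.

Section Wheel.
Variables (i j : I) (r1 r2 : 'I_(k i)) (s : 'I_(k j)).
Hypotheses (ij : adj i j) (r12 : r1 != r2).
Local Notation u := (@wheel_point C n k i j r1 r2 s).

Lemma adj_neq : i != j.
Proof.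
by apply/eqP => e; move: ij; rewrite /adj e orbb => /eqP; apply/eqP; rewrite ltn_eqF.
Qed.

Lemma wheel_point_center : u (xv r1) = X C r1.
Proof. by rewrite /wheel_point (negPf (xv_neq _ _ adj_neq)) (inj_eq (@xv_inj i)) (negPf r12). Qed.

Lemma wheel_point_other : u (xv r2) = rconst _ (v ^- 2) * X C r1.
Proof. by rewrite /wheel_point (negPf (xv_neq _ _ adj_neq)) eqxx. Qed.

(** A wheel point is a scalar times a variable in each coordinate; this
presentation makes its injectivity a finite case analysis on scalars. *)
Definition wheel_scale (a : xvar k) : K :=
  if a == xv s then v^-1 else if a == xv r2 then v ^- 2 else 1.
Definition wheel_var (a : xvar k) : xvar k :=
  if (a == xv s) || (a == xv r2) then xv r1 else a.

Lemma wheel_pointE a : u a = rconst _ (wheel_scale a) * rvar K (wheel_var a).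
Proof.
rewrite /wheel_point /wheel_scale /wheel_var.
by case: (a == _) => //; case: (a == _) => //=; rewrite rconst1 mul1r.
Qed.

Lemma wheel_scale_neq0 a : wheel_scale a != 0.
Proof.
rewrite /wheel_scale; do 2?case: ifP => _; rewrite ?invr_eq0 ?oner_neq0 //.
  exact: v_neq0.
exact: vexp_unit.
Qed.

Lemma wheel_point_neq0 a : u a != 0.
Proof.
have cn : rconst (xvar k) (wheel_scale a) != 0 by rewrite rconst_eq0 wheel_scale_neq0.
by rewrite wheel_pointE; exact: (mulf_neq0 cn (rvar_neq0 K _)).
Qed.

Lemma wheel_point_inj : injective u.
Proof.
have v1 : v^-1 != 1 by rewrite -invr1 (inj_eq invr_inj) -[v]expr1 vexp_neq1.
have v2 : v ^- 2 != 1 by rewrite -invr1 (inj_eq invr_inj) vexp_neq1.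
have v12 : v^-1 != v ^- 2.
  rewrite (inj_eq invr_inj) -{1}[v]mulr1 expr2 (inj_eq (mulfI (v_neq0 C))) eq_sym.
  by rewrite -[v]expr1 vexp_neq1.
move=> a b; rewrite !wheel_pointE => /(rconst_var_inj (wheel_scale_neq0 a)) [].
rewrite /wheel_scale /wheel_var.
by case: (eqVneq a (xv s)) => [->|_]; [|case: (eqVneq a (xv r2)) => [->|_]];
  (case: (eqVneq b (xv s)) => [->|_]; [|case: (eqVneq b (xv r2)) => [->|_]]) => //= _ e;
  move: v1 v2 v12; rewrite ?e ?eqxx // -?e eqxx.
Qed.

End Wheel.

Section IotaFactor.
Variable l : I.

Definition iota_factor : rf C k := \prod_(r < k l) linfac 1 (xv r).

Let hZ := @Zv_subring C.
Let hK := @allK_subring K.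

Lemma laurent_iota_factor (S : K -> Prop) : subring_pred S -> laurent S iota_factor.
Proof.
move=> hS; apply: laurent_prod => // r _; apply: laurent_linfac => //; exact: (subring1 hS).
Qed.

Lemma symspec_iota_factor : symspec iota_factor.
Proof.
move=> s; rewrite {2}/iota_factor (reindex_inj (@perm_inj _ (s l))) /=.
apply: spec_prod => r _; apply: (@spec_linfac_scaled _ _ _ _ _ 1 1).
- exact: oner_neq0.
- by rewrite rconst1 mul1r.
- by rewrite mulr1.
Qed.

Lemma primitive_iota_factor : primitive (@Zv C) iota_factor.
Proof.
apply: primitive_prod => // r _; apply: primitive_linfac => //; exact: subring1 hZ.
Qed.

Lemma inS_iota F : inS F -> inS (iota_factor * F).
Proof.
move=> hF; have [_ [f [lf sf eF]] wF] := hF; split.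
- exact/symspec_symmetric/symspecM/inS_symspec/hF/symspec_iota_factor.
- exists (iota_factor * f); split.
  + by apply: laurentM => //; exact: laurent_iota_factor.
  + apply: symspec_symmetric; apply: symspecM; first exact: symspec_iota_factor.
    exact: laurent_symspec lf sf.
  + by rewrite eF mulrA.
- move=> i j r1 r2 s ij r12.
  have u0 := @wheel_point_neq0 i j r1 r2 s.
  have sP := laurent_regular u0 (laurent_iota_factor hK).
  have sF := inS_regular u0 (@wheel_point_inj i j r1 r2 s) hF.
  by rewrite (spec_subst (specM sP sF)) wF // mulr0.
Qed.

Lemma numer_iota F : numer (iota_factor * F) = iota_factor * numer F.
Proof. by rewrite /numer mulrA. Qed.

Lemma inS_numer F : inS F -> laurent (@allK K) (numer F) /\ symspec (numer F).
Proof.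
case=> _ [f [lf sf ->]] _; rewrite /numer divfK ?poles_neq0 //; split=> //.
exact: laurent_symspec lf sf.
Qed.

Lemma scale_neq0 (T : finType) m : rconst T ((v - v^-1) ^+ m) != 0.
Proof. by rewrite rconst_eq0; apply: expf_neq0; exact: v_sub_vV_neq0. Qed.

Lemma laurent_scaleV (T : finType) m : laurent (@allK K) (rconst T ((v - v^-1) ^+ m))^-1.
Proof. by rewrite -rconstV; apply: laurent_const. Qed.

(** For the converse, primitivity is applied to the numerator of F divided by
(v - v^-1)^|k|, a Laurent polynomial over the field because F is in S. *)
Lemma in_tildeS_iota F : inS F -> in_tildeS F <-> in_tildeS (iota_factor * F).
Proof.
move=> hF; have hPF := inS_iota hF; have [lf sf] := inS_numer hF.
split=> -[_ [g [lg sg e]]]; split=> //.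
  exists (iota_factor * g); split.
  - by apply: laurentM => //; exact: laurent_iota_factor.
  - apply: symspec_symmetric; apply: symspecM; first exact: symspec_iota_factor.
    exact: laurent_symspec lg sg.
  - by rewrite numer_iota e mulrCA.
have A0 := @scale_neq0 (xvar k) (Defs.total k).
set A := rconst _ _ in A0 e.
have lh : laurent (@allK K) (A^-1 * numer F).
  by apply: laurentM => //; exact: laurent_scaleV.
have eg : iota_factor * (A^-1 * numer F) = g.
  by rewrite mulrCA -numer_iota e mulKf.
exists (A^-1 * numer F); split.
- by apply: (primitive_iota_factor).2 => //; rewrite eg.
- apply: symspec_symmetric; apply: symspecM => //.
  by apply: symspecV => //; exact: symspec_const.
- by rewrite mulVKf.
Qed.

Section Splitting.
Variables (d : posroot n -> nat) (sg : xvar k -> yvar d).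

Definition phi_iota_factor : ratfun K (yvar d) :=
  \prod_(r < k l) linfac (v ^+ l.+1) (sg (xv r)).

Lemma munit_phi_point (a : xvar k) :
  munit (@Zv C) (rconst (yvar d) (v ^- (tag a).+1) * Y C (sg a)).
Proof. by apply: munitM => //; [exact: munit_vexpV | exact: munit_var]. Qed.

Lemma phi_iota F : inS F -> phi sg (iota_factor * F) = phi_iota_factor * phi sg F.
Proof.
move=> hF; have [lf _] := inS_numer hF; rewrite /phi numer_iota.
apply: spec_subst; apply: specM; last by apply: laurent_regular lf => a; case: (munit_phi_point a).
apply: spec_prod => r _.
apply: (@spec_linfac_scaled _ _ _ _ _ (v ^- l.+1)); last 1 first.
- by rewrite mulVf // vexp_unit.
- by rewrite invr_eq0 vexp_unit.
- by [].
Qed.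

Lemma varphi_iota F : inS F -> varphi sg (iota_factor * F) = phi_iota_factor * varphi sg F.
Proof. by move=> hF; rewrite /varphi phi_iota // mulrA. Qed.

Lemma laurent_phi_iota_factor (S : K -> Prop) :
  subring_pred S -> (forall m, S (v ^+ m)) -> laurent S phi_iota_factor.
Proof. by move=> hS hv; apply: laurent_prod => // r _; exact: laurent_linfac. Qed.

Lemma primitive_phi_iota_factor : primitive (@Zv C) phi_iota_factor.
Proof.
by apply: primitive_prod => // r _; apply: primitive_linfac => //; exact: Zv_vexp.
Qed.

Lemma yvar_lt_neq (a b : yvar d) : yvar_lt a b -> a != b.
Proof.
apply: contraTneq => ->; rewrite /yvar_lt /root_lt !ltnn !andbF orbF.
by [].
Qed.

Lemma Bfactor_neq0 : Bfactor C d != 0.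
Proof.
apply: prod_ratfun_neq0 => a _; apply: prod_ratfun_neq0 => b /yvar_lt_neq ab.
by apply: mulf_neq0; apply: expf_neq0; exact: vardiff_neq0.
Qed.

Lemma coprime_Bfactor : coprime_laurent (Bfactor C d) phi_iota_factor.
Proof.
have lP := laurent_phi_iota_factor hK (fun _ => Logic.I).
apply: coprime_laurent_prod => // a _; apply: coprime_laurent_prod => // b /yvar_lt_neq ab.
have h c : c != 0 -> coprime_laurent (vardiff c a b) phi_iota_factor.
  move=> hc; apply: coprime_laurentC; apply: coprime_laurent_prod.
    exact: laurent_vardiff.
  move=> r _; apply/coprime_laurentC.
  exact: (coprime_vardiff_linfac _ ab hc (vexp_unit C _)).
apply: coprime_laurentM; apply: coprime_laurent_exp; apply: h.
  by rewrite invr_eq0 vexp_unit.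
exact: vexp_unit.
Qed.

Lemma laurent_phi F : inS F -> laurent (@allK K) (phi sg F).
Proof.
move=> hF; have [lf _] := inS_numer hF; apply: (laurent_spec hK) lf => a.
exact: munit_weaken (munit_phi_point a).
Qed.

(** For the converse, coprimality with B shows that varphi(F) is a Laurent
polynomial over the field, and primitivity that its coefficients are
integral. *)
Lemma laurent_varphi_iota F : inS F ->
  laurent (@Zv C) (varphi sg F) <-> laurent (@Zv C) (varphi sg (iota_factor * F)).
Proof.
move=> hF; rewrite varphi_iota //; split=> [h|h].
  by apply: laurentM => //; apply: laurent_phi_iota_factor => //; exact: Zv_vexp.
apply: primitive_phi_iota_factor.2 => //.
have [_ _ cop] := coprime_Bfactor; apply: cop; last exact: laurent_weaken h.
have -> : Bfactor C d * varphi sg F = (Afactor C k d)^-1 * phi sg F.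
  rewrite /varphi invfM mulrCA [Bfactor C d * _]mulrCA (divff Bfactor_neq0) mulr1.
  by rewrite mulrC.
by apply: laurentM => //; [exact: laurent_scaleV | exact: laurent_phi].
Qed.

Section Grouping.
Variables (lam : posroot n -> nat) (t : forall b, 'I_(lam b) -> nat).
Variable (tau : yvar d -> slot t).

Local Notation upoint := (fun a : yvar d =>
  rconst (zvar lam) (v ^- (2 * (tagged (tau a)).+1)) * rvar K (tag (tau a))).

Definition Upsilon_iota_factor : ratfun K (zvar lam) :=
  \prod_(r < k l) linfac (v ^+ (2 * (tagged (tau (sg (xv r)))).+1) * v ^+ l.+1)
    (tag (tau (sg (xv r)))).

Lemma munit_upoint a : munit (@Zv C) (upoint a).
Proof. by apply: munitM => //; [exact: munit_vexpV | exact: munit_var]. Qed.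

Lemma Upsilon_iota F : inS F -> laurent (@Zv C) (varphi sg F) ->
  Upsilon sg tau (iota_factor * F) = Upsilon_iota_factor * Upsilon sg tau F.
Proof.
move=> hF lF; rewrite /Upsilon varphi_iota //.
apply: spec_subst; apply: specM; last first.
  by apply: laurent_regular lF => a; case: (munit_upoint a).
apply: spec_prod => r _.
set m := (2 * _)%N.
apply: (@spec_linfac_scaled _ _ _ _ _ (v ^- m)); last 1 first.
- by rewrite mulKf // vexp_unit.
- by rewrite invr_eq0 vexp_unit.
- by [].
Qed.

Lemma primitive_Upsilon_iota_factor : primitive (@Zv C) Upsilon_iota_factor.
Proof.
apply: primitive_prod => // r _; apply: primitive_linfac => //.
by apply: subringM => //; exact: Zv_vexp.
Qed.

Lemma Upsilon_iota_divisible F (c : K) : inS F -> laurent (@Zv C) (varphi sg F) ->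
  c != 0 ->
  (exists2 H, laurent (@Zv C) H & Upsilon sg tau F = rconst _ c * H) <->
  (exists2 H, laurent (@Zv C) H &
     Upsilon sg tau (iota_factor * F) = rconst _ c * H).
Proof.
move=> hF lF hc; rewrite Upsilon_iota //; have [lP pP] := primitive_Upsilon_iota_factor.
split=> -[H lH e].
  by exists (Upsilon_iota_factor * H); [exact: laurentM | rewrite e mulrCA].
have cn : rconst (zvar lam) c != 0 by rewrite rconst_eq0.
exists ((rconst _ c)^-1 * Upsilon sg tau F); last by rewrite mulVKf.
apply: pP; last by rewrite mulrCA e mulKf.
apply: laurentM => //; first by rewrite -rconstV; apply: laurent_const.
exact: laurent_weaken (laurent_spec hZ munit_upoint lF).
Qed.

End Grouping.
End Splitting.

Lemma integral_iota F : inS F -> integral F <-> integral (iota_factor * F).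
Proof.
have cn (lam : posroot n -> nat) (t : forall b, 'I_(lam b) -> nat) :
    \prod_(b : posroot n) \prod_(r < lam b) qfact (t b r) != 0 :> K.
  by apply/prodf_neq0 => b _; apply/prodf_neq0 => r _; exact: qfact_neq0.
move=> hF; split=> -[hT h]; split; try exact/(in_tildeS_iota hF).
  move=> d sg hd hsg; have [lF hU] := h d sg hd hsg.
  split; first exact/(laurent_varphi_iota sg hF).
  by move=> lam t tau h1 h2 h3; apply/(Upsilon_iota_divisible _ hF lF (cn lam t))/hU.
move=> d sg hd hsg; have [/(laurent_varphi_iota sg hF) lF hU] := h d sg hd hsg.
split=> // lam t tau h1 h2 h3.
by apply/(Upsilon_iota_divisible _ hF lF (cn lam t))/hU.
Qed.

End IotaFactor.
End FixedDegree.

Section Graded.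
Variable l : I.
Implicit Types F G : graded C n.

Lemma iota'E F k : iota' l F k = iota_factor k l * F k.
Proof.
by rewrite /iota'; congr (_ * _); apply: eq_bigr => r _; rewrite /linfac rconst1 mul1r.
Qed.

Lemma inSn_iota F : inSn F -> inSn (iota' l F).
Proof.
move=> [[s hs] hF]; split=> [|k]; last by rewrite iota'E; exact: inS_iota.
by exists s => k /hs; rewrite iota'E => ->; rewrite mulr0.
Qed.

Lemma integral_n_iota F : inSn F -> integral_n F <-> integral_n (iota' l F).
Proof.
move=> hF; have [fin_iota _] := inSn_iota hF; have [fin hS] := hF.
split=> -[_ h]; split=> // k; have := h k; rewrite iota'E => /(integral_iota l (hS k)).
  by [].
by [].
Qed.

End Graded.
End Multiplication.

(** * Overlaps of positive roots *)

Section RootCombinatorics.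
Variable n : nat.
Local Notation I := 'I_n.-1.

Lemma card_diag (A B : {set I}) :
  #|[set p in finset.setX A B | p.1 == p.2]| = #|A :&: B|.
Proof.
rewrite -(card_imset (mem (A :&: B)) (_ : injective (fun i : I => (i, i)))); last by move=> i j [].
apply: eq_card => -[i j]; rewrite !inE /=; apply/idP/imsetP.
  by move=> /andP[/andP[iA iB] /eqP e]; exists i; rewrite ?inE ?iA ?{1}e ?iB //.
by case=> x; rewrite inE => /andP[xA xB] [-> ->]; rewrite xA xB eqxx.
Qed.

Lemma card_shift (A B : {set I}) :
  #|[set p in finset.setX A B | p.1 == p.2.+1 :> nat]| =
  #|[set j in B | [exists i in A, i == j.+1 :> nat]]|.
Proof.
rewrite -(card_in_imset (f := snd) (D := [set p in _ | _])); last first.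
  move=> [i j] [i' j'] /=; rewrite !inE /= => /andP[_ /eqP e] /andP[_ /eqP e'] jj'.
  by congr (_, _) => //; apply: val_inj; rewrite /= e e' jj'.
apply: eq_card => j; rewrite !inE; apply/imsetP/andP.
  case=> -[i j'] /=; rewrite !inE /= => /andP[/andP[iA jB] e] ->; split=> //.
  by apply/existsP; exists i; rewrite iA.
case=> jB /existsP[i /andP[iA e]]; exists (i, j) => //.
by rewrite !inE /= iA jB.
Qed.

(** If j + 1 is in [b] and j in [b'], where b starts no later than b', then j
is in [b] as well. *)
Lemma shift_subset (b b' : posroot n) : (jroot b <= jroot b')%N ->
  [set j in rsupp b' | [exists i in rsupp b, i == j.+1 :> nat]]
    \subset rsupp b :&: rsupp b'.
Proof.
move=> h; apply/subsetP => j; rewrite !inE => /andP[jb /existsP[i /andP[]]].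
by rewrite inE => ib /eqP e; lia.
Qed.

(** The last colour of b is not counted. *)
Lemma shift_proper (b : posroot n) :
  [set j in rsupp b | [exists i in rsupp b, i == j.+1 :> nat]] \proper rsupp b.
Proof.
have := shift_subset (leqnn (jroot b)); rewrite setIid => sub; rewrite properE sub /=.
apply/subsetPn; exists (iroot b).
  by rewrite inE leqnn andbT; exact: valP b.
rewrite inE; apply/negP => /andP[_ /existsP[i /andP[]]].
by rewrite inE => ib /eqP e; lia.
Qed.

Lemma root_lt_total (b b' : posroot n) : b != b' -> root_lt b' b = ~~ root_lt b b'.
Proof.
move=> ne; rewrite /root_lt -!val_eqE /=.
have : (jroot b != jroot b' :> nat) || (iroot b != iroot b' :> nat).
  apply: contraR ne; rewrite negb_or !negbK => /andP[e1 e2]; rewrite -val_eqE.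
  rewrite /eq_op /=; apply/andP; split; [exact: e1 | exact: e2].
by lia.
Qed.

Variable d : posroot n -> nat.

Lemma yvar_lt_total (a b : yvar d) : a != b -> yvar_lt b a = ~~ yvar_lt a b.
Proof.
case: a b => b r [b' r'] ne; rewrite /yvar_lt /=.
case: (eqVneq b b') => [e|nb]; last by rewrite !orbF root_lt_total.
subst b'; rewrite /root_lt !ltnn !andbF /=.
move: ne; rewrite eq_Tagged -val_eqE /= => ne.
by rewrite -leqNgt [RHS]leq_eqVlt [X in X || _]eq_sym (negPf ne).
Qed.

Lemma yvar_lt_jroot (a b : yvar d) : yvar_lt a b -> (jroot (tag a) <= jroot (tag b))%N.
Proof.
by case/orP=> [/orP[/ltnW|/andP[/eqP-> _]]|/andP[/eqP e _]] //; rewrite e.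
Qed.

Lemma prod_offdiag (A : comPzSemiRingType) (h : yvar d -> yvar d -> A) :
  \prod_a \prod_(b | a != b) h a b =
  \prod_a \prod_(b | yvar_lt a b) (h a b * h b a).
Proof.
have -> : \prod_a \prod_(b | a != b) h a b =
    \prod_a (\prod_(b | yvar_lt a b) h a b * \prod_(b | yvar_lt b a) h a b).
  apply: eq_bigr => a _; rewrite (bigID (yvar_lt a)) /=; congr (_ * _); apply: eq_bigl => b.
    apply/andb_idl; exact: yvar_lt_neq.
  apply/andP/idP => [[ab /negbTE nl]|h']; first by rewrite (yvar_lt_total ab) nl.
  have ba := yvar_lt_neq h'; split; first by rewrite eq_sym.
  by rewrite -(yvar_lt_total (_ : a != b)) // eq_sym.
rewrite big_split /= [X in _ * X](exchange_big_dep xpredT) //= -big_split /=.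
by apply: eq_bigr => a _; rewrite big_split.
Qed.

End RootCombinatorics.

(** * The explicit integral elements *)

Section Element.
Variables (C : fieldType) (n : nat).
Local Notation I := 'I_n.-1.
Local Notation K := (Cv C).
Local Notation v := (@v C).
#[local] Opaque Cv ratfun.

Section Assoc.
Variable T : finType.
Let hZ := @Zv_subring C.

(** Equality up to a unit of the Laurent polynomial ring over C[v,v^-1]. *)
Definition assoc (x y : ratfun K T) : Prop := exists2 w, munit (@Zv C) w & x = w * y.

Lemma assoc_refl x : assoc x x.
Proof. by exists 1; [exact: munit1 | rewrite mul1r]. Qed.

Lemma assoc_trans y x z : assoc x y -> assoc y z -> assoc x z.
Proof.
by move=> [w hw ->] [w' hw' ->]; exists (w * w'); [exact: munitM | rewrite mulrA].
Qed.

Lemma assocM x x' y y' : assoc x y -> assoc x' y' -> assoc (x * x') (y * y').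
Proof.
by move=> [w hw ->] [w' hw' ->]; exists (w * w'); [exact: munitM | rewrite mulrACA].
Qed.

Lemma assocX k x y : assoc x y -> assoc (x ^+ k) (y ^+ k).
Proof.
by move=> h; elim: k => [|k IH]; [exact: assoc_refl | rewrite !exprS; exact: assocM].
Qed.

Lemma assoc_prod J (r : seq J) (P : pred J) (f g : J -> ratfun K T) :
  (forall j, P j -> assoc (f j) (g j)) ->
  assoc (\prod_(j <- r | P j) f j) (\prod_(j <- r | P j) g j).
Proof.
move=> h; apply: (big_ind2 assoc) => //; first exact: assoc_refl.
by move=> x1 x2 y1 y2; exact: assocM.
Qed.

Lemma assoc_vardiff_swap (a b : T) :
  assoc (vardiff (v ^- 2) b a) (vardiff (v ^+ 2) a b).
Proof.
exists (- rconst T (v ^- 2)).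
  have [n1 l1 l2] := munit_vexpV C T 2; split.
  - by rewrite oppr_eq0.
  - by rewrite -sub0r; apply: laurentB => //; exact: laurent0.
  - by rewrite invrN -sub0r; apply: laurentB => //; exact: laurent0.
rewrite /vardiff mulNr mulrBr opprB; congr (_ - _).
by rewrite mulrA -rconstM (mulVf (vexp_unit C 2)) rconst1 mul1r.
Qed.

End Assoc.

Variables (k : degree n) (g : forall i : I, ratfun K 'I_(k i)).
Hypothesis g_sym : forall i, int_symmetric (g i).
Let hZ := @Zv_subring C.
Let hK := @allK_subring K.

Lemma Zv_v2V : Zv (v ^- 2 : K).
Proof. exact: Zv_vexpV. Qed.

(** The two factors of the numerator: the product of the
x_{i,r} - v^-2 x_{i,r'} over r <> r', and the product of the g_i. *)
Definition zeta_prod : rf C k :=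
  \prod_(i : I) \prod_(r < k i) \prod_(r' < k i | r != r')
    vardiff (v ^- 2) (xv r) (xv r').

Definition sym_prod : rf C k := \prod_(i : I) subst (fun r : 'I_(k i) => X C r) (g i).

Definition scale : rf C k := rconst _ ((v - v^-1) ^+ Defs.total k).

Lemma elementFE : elementF g = scale * (zeta_prod * sym_prod) / poles C k.
Proof. by []. Qed.

Lemma numer_element : numer (elementF g) = scale * (zeta_prod * sym_prod).
Proof. by rewrite /numer elementFE divfK ?poles_neq0. Qed.

Lemma zeta_prod_spec (T' : finType) (u : xvar k -> ratfun K T') :
  spec u zeta_prod (\prod_(i : I) \prod_(r < k i) \prod_(r' < k i | r != r')
    (u (xv r) - rconst _ (v ^- 2) * u (xv r'))).
Proof.
do 3!(apply: spec_prod => ? _); apply: specB; first exact: spec_var.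
by apply: specM; [exact: spec_const | exact: spec_var].
Qed.

Lemma laurent_zeta_prod : laurent (@Zv C) zeta_prod.
Proof.
do 3!(apply: laurent_prod => // ? _); apply: laurent_vardiff => //; exact: Zv_v2V.
Qed.

Lemma laurent_sym_prod : laurent (@Zv C) sym_prod.
Proof.
apply: laurent_prod => // i _; apply: laurent_spec (g_sym i).1 => // r.
exact: munit_var.
Qed.

Lemma symspec_zeta_prod : symspec zeta_prod.
Proof.
move=> s; have := zeta_prod_spec (permpt C s).
suff -> : \prod_(i : I) \prod_(r < k i) \prod_(r' < k i | r != r')
   (permpt C s (xv r) - rconst _ (v ^- 2) * permpt C s (xv r')) = zeta_prod by [].
apply: eq_bigr => i _; rewrite [RHS](reindex_inj (@perm_inj _ (s i))).
apply: eq_bigr => r _; rewrite [RHS](reindex_inj (@perm_inj _ (s i))).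
by apply: eq_bigl => r'; rewrite (inj_eq perm_inj).
Qed.

(** Substituting the permuted variables in g_i amounts to permuting the
variables of g_i first, which does not change it. *)
Lemma symspec_sym_prod : symspec sym_prod.
Proof.
move=> s; apply: spec_prod => i _; have [lg sg] := g_sym i.
pose u'' (r : 'I_(k i)) : rf C k := X C (s i r).
have s1 : spec u'' (g i) (subst u'' (g i)).
  by apply: laurent_regular lg => r; exact: rvar_neq0.
have s2 : spec (permpt C s) (subst (fun r : 'I_(k i) => X C r) (g i)) (subst u'' (g i)).
  by apply: spec_comp s1 => r; exact: (spec_var (permpt C s) (xv r)).
suff e : subst (fun r : 'I_(k i) => X C r) (g i) = subst u'' (g i).
  by rewrite {2}e; exact: s2.
rewrite -{1}(sg (s i)); apply: spec_subst; apply: spec_comp s1 => r.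
exact: (spec_var (fun r : 'I_(k i) => X C r)).
Qed.

(** The factor x_{i,r2} - v^-2 x_{i,r1} vanishes at the wheel point. *)
Lemma wheel_zeta_prod (i j : I) (r1 r2 : 'I_(k i)) (s : 'I_(k j)) :
  adj i j -> r1 != r2 -> subst (@wheel_point C n k i j r1 r2 s) zeta_prod = 0.
Proof.
move=> ij r12; set u := wheel_point C r1 r2 s.
rewrite (spec_subst (zeta_prod_spec u)) (bigD1 i) //= (bigD1 r2) //= (bigD1 r1) /=;
  last by rewrite eq_sym.
by rewrite /u wheel_point_center // wheel_point_other // subrr !mul0r.
Qed.

Lemma inS_element : inS (elementF g).
Proof.
have lf : laurent (@Zv C) (zeta_prod * sym_prod).
  exact: (laurentM hZ laurent_zeta_prod laurent_sym_prod).
have sf : symspec (scale * (zeta_prod * sym_prod)).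
  apply: symspecM; first exact: symspec_const.
  exact: symspecM symspec_zeta_prod symspec_sym_prod.
rewrite elementFE; split.
- apply: symspec_symmetric; apply: symspecM => //.
  by apply: symspecV; [exact: poles_neq0 | exact: symspec_poles].
- exists (scale * (zeta_prod * sym_prod)); split=> //; last exact: symspec_symmetric.
  by apply: laurentM => //; [exact: laurent_const | exact: laurent_weaken lf].
move=> i j r1 r2 s ij r12.
have u0 := @wheel_point_neq0 C n k i j r1 r2 s.
have [w wn sw] := poles_spec_neq0 (@wheel_point_inj C n k i j r1 r2 s).
have sN := laurent_regular u0 laurent_zeta_prod.
have sG := laurent_regular u0 laurent_sym_prod.
rewrite wheel_zeta_prod // in sN.
have sA := spec_const (wheel_point C r1 r2 s) ((v - v^-1) ^+ Defs.total k).
have := specM (specM sA (specM sN sG)) (specV wn sw).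
by rewrite mul0r mulr0 mul0r; exact: spec_subst.
Qed.

Lemma in_tildeS_element : in_tildeS (elementF g).
Proof.
split; first exact: inS_element.
exists (zeta_prod * sym_prod); split; last exact: numer_element.
  exact: (laurentM hZ laurent_zeta_prod laurent_sym_prod).
apply: symspec_symmetric; exact: symspecM symspec_zeta_prod symspec_sym_prod.
Qed.

Section Splitting.
Variables (d : posroot n -> nat) (sg : xvar k -> yvar d).
Hypothesis hsg : splitting sg.
Local Notation Dm := (@vardiff K (yvar d) (v ^- 2)).
Local Notation Dp := (@vardiff K (yvar d) (v ^+ 2)).

Local Notation upoint :=
  (fun a : xvar k => rconst (yvar d) (v ^- (tag a).+1) * Y C (sg a)).

(** The groups that contain a variable of colour i are those whose root
contains i, and each contains one such variable. *)
Lemma prod_splitting (A : comPzSemiRingType) (i : I) (Q : pred (yvar d)) (f : yvar d -> A) :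
  \prod_(r < k i | Q (sg (xv r))) f (sg (xv r)) =
  \prod_(b | (i \in rsupp (tag b)) && Q b) f b.
Proof.
have [h1 h2] := hsg.
rewrite (partition_big (fun r => sg (xv r)) (fun b => (i \in rsupp (tag b)) && Q b)) /=.
  apply: eq_bigr => b /andP[ib Qb]; have [r0 [e0 u0]] := h2 b i ib.
  rewrite (big_pred1 r0) ?e0 // => r; apply/andP/eqP => [[_ /eqP /u0 ->] //|->].
  by rewrite e0.
by move=> r ->; rewrite andbT; exact: (h1 (xv r)).
Qed.

Lemma splitting_inj (i : I) : injective (fun r : 'I_(k i) => sg (xv r)).
Proof.
move=> r r' e; have [h1 h2] := hsg.
have [r0 [_ u0]] := h2 (sg (xv r)) i (h1 (xv r)).
by rewrite -(u0 r erefl) -(u0 r' (esym e)).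
Qed.

Definition overlap (a b : yvar d) : nat := #|rsupp (tag a) :&: rsupp (tag b)|.
Definition shift_overlap (a b : yvar d) : nat :=
  #|[set p in finset.setX (rsupp (tag a)) (rsupp (tag b)) | p.1 == p.2.+1 :> nat]|.

Definition phi_zeta : ratfun K (yvar d) :=
  \prod_(i : I) \prod_(r < k i) \prod_(r' < k i | r != r')
    (upoint (xv r) - rconst _ (v ^- 2) * upoint (xv r')).

(** Colour i contributes one factor D(a, b), up to a power of v, for each pair
of distinct groups a and b whose roots both contain i. *)
Lemma phi_zeta_offdiag :
  assoc phi_zeta (\prod_a \prod_(b | a != b) Dm a b ^+ overlap a b).
Proof.
pose S i := \prod_(a | i \in rsupp (tag a))
   \prod_(b | (i \in rsupp (tag b)) && (a != b)) Dm a b.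
have e : \prod_a \prod_(b | a != b) Dm a b ^+ overlap a b = \prod_(i : I) S i.
  rewrite /S [RHS](exchange_big_dep xpredT) //=; apply: eq_bigr => a _.
  rewrite [RHS](exchange_big_dep (fun b => a != b)) /=; last by move=> i b _ /andP[].
  apply: eq_bigr => b ab; rewrite -prodr_const; apply: eq_bigl => i.
  by rewrite inE ab andbT.
rewrite e; apply: assoc_prod => i _.
have -> : S i = \prod_(r < k i) \prod_(r' < k i | r != r') Dm (sg (xv r)) (sg (xv r')).
  rewrite /S -[in LHS](eq_bigl _ _ (fun a => andbT (i \in rsupp (tag a)))).
  rewrite -(prod_splitting i xpredT); apply: eq_bigr => r _.
  rewrite -(prod_splitting i (fun b => sg (xv r) != b)); apply: eq_bigl => r'.
  by rewrite (inj_eq (@splitting_inj i)).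
apply: assoc_prod => r _; apply: assoc_prod => r' _.
exists (rconst _ (v ^- i.+1)); first exact: munit_vexpV.
by rewrite /vardiff mulrBr [RHS]/= mulrCA.
Qed.

Lemma phi_zeta_ordered :
  assoc phi_zeta (\prod_a \prod_(b | yvar_lt a b) (Dm a b ^+ overlap a b * Dp a b ^+ overlap a b)).
Proof.
apply: assoc_trans phi_zeta_offdiag _; rewrite prod_offdiag.
apply: assoc_prod => a _; apply: assoc_prod => b _; apply: assocM; first exact: assoc_refl.
rewrite /overlap setIC; apply: assocX; exact: assoc_vardiff_swap.
Qed.

(** What remains of the factor indexed by a < b after division by B. *)
Definition cofactor_term (a b : yvar d) : ratfun K (yvar d) :=
  Dm a b ^+ (tag a == tag b) * Dp a b ^+ (overlap a b - shift_overlap a b).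
Definition cofactor : ratfun K (yvar d) :=
  \prod_a \prod_(b | yvar_lt a b) cofactor_term a b.

Lemma shift_overlap_le (a b : yvar d) : yvar_lt a b -> (shift_overlap a b <= overlap a b)%N.
Proof.
move=> /yvar_lt_jroot h; rewrite /shift_overlap card_shift.
exact/subset_leq_card/shift_subset.
Qed.

Lemma shift_overlap_lt (a b : yvar d) : tag a = tag b -> (shift_overlap a b < overlap a b)%N.
Proof.
move=> e; rewrite /shift_overlap /overlap card_shift e setIid.
exact/proper_card/shift_proper.
Qed.

(** The truncated subtractions in the exponents of B and of the cofactor are
genuine ones, by the comparison of overlaps. *)
Lemma phi_zeta_factor : assoc phi_zeta (Bfactor C d * cofactor).
Proof.
suff -> : Bfactor C d * cofactor = \prod_a \prod_(b | yvar_lt a b)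
    (Dm a b ^+ overlap a b * Dp a b ^+ overlap a b) by exact: phi_zeta_ordered.
rewrite /Bfactor /cofactor -big_split; apply: eq_bigr => a _.
rewrite -big_split; apply: eq_bigr => b ab /=.
rewrite /cofactor_term mulrACA card_diag -!exprD; congr (_ ^+ _ * _ ^+ _).
  rewrite subnK //; case: eqP => // e.
  exact: leq_ltn_trans (shift_overlap_lt e).
by rewrite subnKC // shift_overlap_le.
Qed.

Definition phi_sym : ratfun K (yvar d) := subst upoint sym_prod.

Lemma phi_element : phi sg (elementF g) = Afactor C k d * (phi_zeta * phi_sym).
Proof.
rewrite /phi numer_element; apply: spec_subst.
apply: specM; first exact: spec_const.
apply: specM; last first.
  by apply: laurent_regular laurent_sym_prod => a; case: (munit_phi_point C sg a).
exact: zeta_prod_spec.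
Qed.

Lemma laurent_phi_sym : laurent (@Zv C) phi_sym.
Proof. by apply: (laurent_spec hZ) laurent_sym_prod => a; exact: munit_phi_point. Qed.

Lemma laurent_cofactor_term a b : laurent (@Zv C) (cofactor_term a b).
Proof.
apply: laurentM => //; apply: laurent_exp => //; apply: laurent_vardiff => //.
  exact: Zv_v2V.
exact: Zv_vexp.
Qed.

Lemma laurent_cofactor : laurent (@Zv C) cofactor.
Proof. by do 2!(apply: laurent_prod => // ? _); exact: laurent_cofactor_term. Qed.

Lemma varphi_element : assoc (varphi sg (elementF g)) (cofactor * phi_sym).
Proof.
have [w hw e] := phi_zeta_factor; exists w => //.
have A0 : Afactor C k d != 0 by exact: scale_neq0.
have B0 := Bfactor_neq0 C d.
rewrite /varphi phi_element e.
rewrite -mulf_div (divff A0) mul1r [w * _]mulrCA -[_ * _ * phi_sym]mulrA mulrC (mulKf B0).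
by rewrite mulrA.
Qed.

Lemma laurent_varphi_element : laurent (@Zv C) (varphi sg (elementF g)).
Proof.
have [w [_ lw _] ->] := varphi_element.
apply: (laurentM hZ lw); exact: (laurentM hZ laurent_cofactor laurent_phi_sym).
Qed.

Section Grouping.
Variables (lam : posroot n -> nat) (t : forall b, 'I_(lam b) -> nat).
Variable (tau : yvar d -> slot t).

Local Notation zpoint := (fun a : yvar d =>
  rconst (zvar lam) (v ^- (2 * (tagged (tau a)).+1)) * rvar K (tag (tau a))).

(** If a0 and a1 receive consecutive points of a string, then
y_{a0} = v^2 y_{a1}. Depending on which of them comes first, this kills the
factor y_{a1} - v^-2 y_{a0}, of exponent 1, or y_{a0} - v^2 y_{a1}, of
exponent c - e > 0. *)
Lemma cofactor_vanishes (a0 a1 : yvar d) :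
  tag a0 = tag a1 -> tag (tau a0) = tag (tau a1) ->
  (tagged (tau a1) = (tagged (tau a0)).+1 :> nat) ->
  subst zpoint cofactor = 0.
Proof.
move=> e01 ez ep; set u := zpoint.
have ne : a0 != a1.
  apply: contra_eq_neq ep => ->; rewrite eq_sym; apply: negbT; exact: gtn_eqF.
have u01 : u a0 = rconst _ (v ^+ 2) * u a1.
  rewrite /u mulrA -rconstM; congr (rconst _ _ * rvar K _); last exact: ez.
  by rewrite ep [in RHS]mulnS exprD invfM mulrA (divff (vexp_unit C 2)) mul1r.
have u10 : u a1 = rconst _ (v ^- 2) * u a0.
  by rewrite u01 mulrA -rconstM mulVf ?vexp_unit // rconst1 mul1r.
have s c a b : spec u (vardiff c a b) (u a - rconst _ c * u b).
  apply: specB; first exact: spec_var.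
  by apply: specM; [exact: spec_const | exact: spec_var].
have sT a b : spec u (cofactor_term a b)
   ((u a - rconst _ (v ^- 2) * u b) ^+ (tag a == tag b) *
    (u a - rconst _ (v ^+ 2) * u b) ^+ (overlap a b - shift_overlap a b)).
  by apply: specM; apply: spec_exp; exact: s.
have h := spec_prod (index_enum (yvar d)) (fun a (_ : true) =>
  spec_prod (index_enum (yvar d)) (fun b (_ : yvar_lt a b) => sT a b)).
rewrite (spec_subst h).
have [lt01|lt10] := boolP (yvar_lt a0 a1).
  rewrite (bigD1 a0) //= (bigD1 a1) //= -u01 subrr.
  rewrite [0 ^+ (overlap _ _ - _)]expr0n subn_eq0 leqNgt shift_overlap_lt //= mulr0.
  by rewrite !mul0r.
rewrite (bigD1 a1) //= (bigD1 a0) /=; last by rewrite yvar_lt_total.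
by rewrite -u10 subrr e01 eqxx expr1 !mul0r.
Qed.

Lemma Upsilon_element_vanishes (b : posroot n) (r : 'I_(lam b)) :
  grouping tau -> (1 < t r)%N -> Upsilon sg tau (elementF g) = 0.
Proof.
move=> [[inv invK tauK] htag] tr.
(* A string of length at least 2 has points at the positions 0 and 1. *)
pose slot_at (p : 'I_(t r)) : slot t :=
  existT (fun z : zvar lam => 'I_(@t (tag z) (tagged z))) (zv r) p.
pose p0 : 'I_(t r) := Ordinal (ltnW tr); pose p1 : 'I_(t r) := Ordinal tr.
have [w [_ lw _] e] := varphi_element.
have un a : zpoint a != 0 by case: (munit_upoint C tau a).
have s := specM (laurent_regular un lw) (specM (laurent_regular un laurent_cofactor)
  (laurent_regular un laurent_phi_sym)).
rewrite /Upsilon e (spec_subst s) (@cofactor_vanishes (inv (slot_at p0)) (inv (slot_at p1))).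
- by rewrite mul0r mulr0.
- by rewrite -!htag !tauK.
- by rewrite !tauK.
- by rewrite !tauK.
Qed.

Lemma Upsilon_element_divisible :
  (forall b r, (0 < t (b:=b) r)%N) -> grouping tau ->
  exists2 H : ratfun K (zvar lam), laurent (@Zv C) H &
    Upsilon sg tau (elementF g) =
      rconst _ (\prod_(b : posroot n) \prod_(r < lam b) qfact (t r)) * H.
Proof.
move=> tpos htau.
have [/existsP[b /existsP[r tr]]|small] := boolP [exists b, [exists r : 'I_(lam b), 1 < t r]%N].
  exists 0; first exact: laurent0.
  by rewrite (Upsilon_element_vanishes htau tr) mulr0.
exists (Upsilon sg tau (elementF g)).
  by apply: (laurent_spec hZ) laurent_varphi_element => a; exact: munit_upoint.
rewrite big1 ?rconst1 ?mul1r // => b _; rewrite big1 // => r _.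
suff -> : t r = 1%N by exact: qfact1.
apply/eqP; rewrite eqn_leq tpos andbT leqNgt; apply: contra small => h.
by apply/existsP; exists b; apply/existsP; exists r.
Qed.

End Grouping.
End Splitting.

Lemma integral_element : integral (elementF g).
Proof.
split; first exact: in_tildeS_element.
move=> d sg _ hsg; split; first exact: laurent_varphi_element.
by move=> lam t tau tpos _; exact: Upsilon_element_divisible.
Qed.

End Element.

Theorem proposition3p42 (R : realType) (n : nat) (hn : (2 <= n)%N) :
  (forall l : 'I_n.-1,
     (forall F : graded R[i] n, inSn F -> inSn (iota' l F)) /\
     (forall (c : Cv R[i]) (F G : graded R[i] n) (k : degree n),
        iota' l (fun k' => rconst _ c * F k' + G k') k =
        rconst _ c * iota' l F k + iota' l G k) /\
     (forall F : graded R[i] n, inSn F ->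
        (integral_n F <-> integral_n (iota' l F)))) /\
  (forall (k : degree n)
          (g : forall i : 'I_n.-1, ratfun (Cv R[i]) 'I_(k i)),
     (forall i, int_symmetric (g i)) ->
     integral (elementF g)).
Proof.
split=> [l|k g hg]; last exact: integral_element.
split; first exact: inSn_iota.
split; last exact: integral_n_iota.
by move=> c F G k; rewrite /iota' mulrDr mulrCA.
Qed.
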